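(* Let $K$ be a field with algebraic closure $\overline{K}$. For every positive integer $N$ let $R_N$ be a subgroup of $\overline{K}^\times$ such that the index $|R_NK^\times:K^\times|$ divides $N^c$ for some constant $c$ (independent of $N$), such that $R_1\subseteq K^\times$, and such that $R_N^M=R_{N/M}$ for every $M\mid N$. Suppose that there are only finitely many primes $p$ such that $\zeta_p\notin K^\times$ and $\zeta_p\in R_NK^\times$ for some $N$, and let $z$ be their product. Suppose moreover that the index $|\mu_\infty(K(\zeta_{4z})^\times):\mu_\infty(K^\times)|$ is finite. Then there exists a positive integer $N_0$ such that for every positive integer $N$ $$\frac{[K(R_N):K]}{|R_NK^\times:K^\times|}=\frac{[K(R_{\gcd(N,N_0)}):K]}{|R_{\gcd(N,N_0)}K^\times:K^\times|}\,.$$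
   Context: For $m$ coprime to $\mathrm{char}(K)$, $\zeta_m$ denotes a fixed primitive $m$-th root of unity in $\overline{K}$, chosen coherently ($\zeta_M^{M/m}=\zeta_m$ when $m\mid M$). For a subgroup $H\subseteq\overline{K}^\times$, $\mu_\infty(H)$ denotes the subgroup of all roots of unity in $H$.
   Formalization: The equality of ratios is asserted only for those N for which K(R_N)/K is separable (automatic for perfect K or N prime to char K); without this it fails, e.g. for K = F̄_p(t), R_N = all N-th roots of elements of ⟨t, 1+t⟩, N = p^e. *)

(* Defs.v *)
From HB Require Import structures.
From mathcomp Require Import all_boot all_order all_algebra separable.
From mathcomp Require Import finmap mathcomp_extra boolp classical_sets.
From mathcomp Require Import functions cardinality.

Set Implicit Arguments.
Unset Strict Implicit.
Unset Printing Implicit Defensive.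

Import GRing.Theory.

Local Open Scope classical_set_scope.
Local Open Scope ring_scope.

Section Multiplicative.
Variable L : fieldType.

Definition nonzero (F : set L) : set L := F `\ 0.

Definition mul_subgroup (H : set L) : Prop :=
  ~ H 0 /\ GRing.divr_closed [in H].

Definition mul_set (A B : set L) : set L := [set x * y | x in A & y in B].

Definition power_set (A : set L) (M : nat) : set L := [set x ^+ M | x in A].

Definition mu_infty (H : set L) : set L :=
  [set x | H x /\ exists2 n : nat, (0 < n)%N & x ^+ n = 1].

Definition cosets (H G : set L) : set (set L) :=
  [set [set x * y | y in G] | x in H].

(* The index |H : G| of subgroups G of H. It is 0 when the index is infinite,
   hence [group_index H G %| N ^ c] with N > 0 forces the index to be finite. *)
Definition group_index (H G : set L) : nat := #|` fset_set (cosets H G)|%fset.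

End Multiplicative.

Section Extension.
Variables (K : fieldType) (L : closedFieldType) (iota : {rmorphism K -> L}).

Definition base_units : set L := nonzero (range iota).

Definition is_subfield (F : set L) : Prop := GRing.divring_closed [in F].

Definition adjoin (S : set L) : set L :=
  smallest is_subfield (range iota `|` S).

Definition has_basis (F : set L) (n : nat) : Prop :=
  exists e : 'I_n -> L, (forall i, F (e i)) /\
    forall x, F x -> exists! a : {ffun 'I_n -> K},
      x = \sum_(i < n) iota (a i) * e i.

(* [F : K] for an intermediate field F, and 0 when it is infinite. *)
Definition degree (F : set L) : nat := xget 0%N (has_basis F).

(* An irreducible polynomial over K vanishing at x is, up to a scalar, the
   minimal polynomial of x over K. *)
Definition separable_ext (F : set L) : Prop :=
  forall x, F x -> exists p : {poly K},
    [/\ irreducible_poly p, separable_poly p & root (map_poly iota p) x].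

(* [[pchar K]^'.-nat m] says that m is positive and coprime to char(K); every
   positive m qualifies when char(K) = 0. *)
Definition coherent_roots (zeta : nat -> L) : Prop :=
  (forall m, [pchar K]^'.-nat m -> m.-primitive_root (zeta m)) /\
  (forall m M, [pchar K]^'.-nat M -> (m %| M)%N ->
     zeta M ^+ (M %/ m)%N = zeta m).

Definition new_root_primes (zeta : nat -> L) (R : nat -> set L) : set nat :=
  [set p | [/\ prime p, p \notin [pchar K], ~ base_units (zeta p) &
    exists2 N, (0 < N)%N & mul_set (R N) base_units (zeta p)]].

(* K(zeta_m), where for m divisible by char(K) zeta_m stands for a generator
   of the group of m-th roots of unity, whose order is the largest divisor of
   m coprime to char(K). *)
Definition cyclotomic_ext (zeta : nat -> L) (m : nat) : set L :=
  adjoin [set zeta (m`_([pchar K]^'))%N].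

(* The quotient [K(R) : K] / |R K^* : K^*|. *)
Definition kummer_ratio (R : set L) : rat :=
  (degree (adjoin R))%:R / (group_index (mul_set R base_units) base_units)%:R.

End Extension.

(* Main.v *)
Require Import Defs.
From HB Require Import structures.
From mathcomp Require Import all_boot all_order all_algebra separable.
From mathcomp Require Import finmap mathcomp_extra boolp classical_sets.
From mathcomp Require Import functions cardinality.
From mathcomp Require Import cyclic fieldext zify ring.

(* Write G_N = R_N K^* and E = K(zeta_4z). Elements of G_N lying in E are torsion
   modulo K^*, and E^* has finite torsion modulo K^*: if r ^ k is in K, then
   sigma(r) / r is a root of unity of bounded order for every sigma in Gal(E/K)
   since mu(E) / mu(K) is finite. As G_N and G_M meet in G_gcd(N,M), there is N_0
   such that G_N and G_gcd(N,N_0) contain the same elements of E.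
   By Kneser's theorem, representatives of R_N E^* / E^* are linearly independent
   over E. Kneser's hypothesis holds over E: for a prime q prime to 4z with zeta_q
   not in K, elements of R_N of q-power order modulo K^* and lying in an abelian
   extension of K are roots of unity times elements of K, hence lie in K
   as zeta_q is not in G_N.
   Put N' = gcd(N, N_0). Representatives of G_N / G_N' are then linearly
   independent over E(R_N'), hence over K(R_N'), and they generate K(R_N). So the
   degree and the index are multiplied by the same number from N' to N. *)

Set Implicit Arguments.
Unset Strict Implicit.
Unset Printing Implicit Defensive.

Import GRing.Theory.

Local Open Scope classical_set_scope.
Local Open Scope ring_scope.

(** * Radical extensions of prime degree *)

(** Independence fails over [K] itself as soon as [G_N] contains some [zeta_p] outside [K], because
    [1 + zeta_p + ... + zeta_p^(p-1) = 0]. It can also fail when [-1] is not a square, because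
    [-4 = (1 + i)^4]. Enlarging the base to [E] removes both obstructions; the second one explains
    the factor 4. The price is that elements inequivalent modulo [K^*] may become equivalent modulo
    [E^*]. That loss is governed by the elements of [G_N] lying in [E]. Since [N_0] makes all of
    these appear in [G_N'] already, [G_N / G_N'] injects into [R_N E^* / R_N' E^*]. In Kneser's
    theorem, [K(a)] with [a ^ p = c] acts through the companion matrix of [X^p - c], so determinants
    and traces of matrices serve as norms and traces of elements. The Galois group of [E] over [K]
    is represented by the exponents [c] for which [zeta ^ c] is conjugate to [zeta]. Separability of
    [K(R_N)] makes the orders of elements of [G_N] modulo [K^*] prime to the characteristic. *)

Section PureExtension.
Variable K : fieldType.

(** Bezout: with [u * d = v * p + 1], the element [x ^+ u / c ^+ v] is a [p]-th root of [c]. *)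
Lemma root_of_coprime_exp (c x : K) (d p : nat) :
  (0 < d)%N -> (0 < p)%N -> coprime d p -> c ^+ d = x ^+ p ->
  exists y, c = y ^+ p.
Proof.
move=> d_gt0 p_gt0 /eqP cop cx; have [-> | c0] := eqVneq c 0.
  by exists 0; rewrite expr0n eqn0Ngt p_gt0.
case: (egcdnP p d_gt0) => u v uv _; exists (x ^+ u / c ^+ v).
rewrite expr_div_n -!exprM [(u * p)%N]mulnC [(x ^+ _)]exprM -cx -exprM.
by rewrite [(d * u)%N]mulnC uv cop exprD expr1 mulrC mulKf // expf_neq0.
Qed.

Lemma companion_exists (f : {poly K}) n :
  f \is monic -> size f = n.+2 -> exists A : 'M[K]_n.+1, char_poly A = f.
Proof.
move=> mf sf; have : exists A : 'M[K]_((size f).-1), char_poly A = f.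
  by exists (companionmx f); rewrite companionmxK.
by rewrite sf.
Qed.

Lemma det_expmx n (A : 'M[K]_n.+1) k : \det (A ^+ k) = \det A ^+ k.
Proof. by elim: k => [|k IHk]; rewrite ?expr0 ?det1 // !exprS -IHk -det_mulmx. Qed.

Lemma horner_mx_eq0_dvd n (A : 'M[K]_n.+1) (p : {poly K}) :
  char_poly A %| p -> horner_mx A p = 0.
Proof.
move=> /Pdiv.Field.dvdpP[q ->].
by rewrite rmorphM /= Cayley_Hamilton mulr0.
Qed.

Lemma horner_mx_XnsubC n (A : 'M[K]_n.+1) p c :
  horner_mx A ('X^p - c%:P) = A ^+ p - c%:M.
Proof. by rewrite rmorphB rmorphXn /= horner_mx_X horner_mx_C. Qed.

(* If a proper factor has degree d, its companion matrix C satisfies C ^ p = c,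
   so that (det C) ^ p = c ^ d. *)
Lemma irreducible_XnsubC (p : nat) (c : K) : prime p ->
  (forall y, c <> y ^+ p) -> irreducible_poly ('X^p - c%:P).
Proof.
move=> pp nc; have p0 := prime_gt0 pp.
have sf : size ('X^p - c%:P) = p.+1 by rewrite size_XnsubC.
split=> [|q sq qf]; first by rewrite sf ltnS.
have f0 : 'X^p - c%:P != 0 by rewrite -size_poly_gt0 sf.
have q0 : q != 0 by apply: contraTneq qf => ->; rewrite dvd0p.
rewrite -dvdp_size_eqp // sf eqn_leq -{1}sf (dvdp_leq f0 qf) /=.
rewrite leqNgt ltnS; apply/negP => le_q.
set q' := (lead_coef q)^-1 *: q.
have lq : (lead_coef q)^-1 != 0 by rewrite invr_eq0 lead_coef_eq0.
have mq : q' \is monic.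
  by rewrite monicE lead_coefZ mulVf // lead_coef_eq0.
have q'f : q' %| 'X^p - c%:P by rewrite dvdpZl.
have sq' : size q' = size q by rewrite size_scale.
have : (1 < size q)%N by rewrite ltn_neqAle eq_sym sq size_poly_gt0.
case E: (size q) => [|[|d]] // _.
have [A cA] := companion_exists mq (etrans sq' E).
have := @horner_mx_eq0_dvd _ A ('X^p - c%:P); rewrite cA => /(_ q'f).
rewrite horner_mx_XnsubC => /eqP; rewrite subr_eq0 => /eqP Ap.
have : \det A ^+ p = c ^+ d.+1.
  by rewrite -det_expmx Ap det_scalar.
move/esym/root_of_coprime_exp; case=> //.
  rewrite coprime_sym prime_coprime //; apply/negP => /dvdn_leq.
  by move=> /(_ isT); rewrite leqNgt -ltnS -E ltnS le_q.
Qed.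

(** The irreducible polynomial [X^p - k], with [p = n.+1], kills [U]. It is therefore the minimal
    polynomial of [U] and, by degree, the characteristic one; its coefficient in degree [p - 1] is
    zero. *)
Lemma trace_root_scalar n (U : 'M[K]_n.+1) (k : K) : prime n.+1 ->
  (forall y, k <> y ^+ n.+1) -> U ^+ n.+1 = k%:M -> \tr U = 0.
Proof.
move=> pp nk Uk; have irr := irreducible_XnsubC pp nk.
have f0 : horner_mx U ('X^(n.+1) - k%:P) = 0.
  by rewrite horner_mx_XnsubC Uk subrr.
have mf : mxminpoly U %= 'X^(n.+1) - k%:P.
  apply: irr; last exact: mxminpoly_min.
  by rewrite size_mxminpoly eqSS -lt0n mxminpoly_nonconstant.
have e : char_poly U = 'X^(n.+1) - k%:P.
  apply/eqP; rewrite -eqp_monic ?char_poly_monic ?monicXnsubC //.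
  rewrite eqp_sym -dvdp_size_eqp ?size_char_poly ?size_XnsubC //.
  by rewrite -(eqp_dvdl _ mf) mxminpoly_dvd_char.
have := char_poly_trace U (ltn0Sn n); rewrite e /= coefB coefXn coefC.
have n0 : n != 0%N by case: (n) pp.
by rewrite (negPf n0) eqn_leq ltnn andbF subr0 => /esym/eqP;
  rewrite oppr_eq0 => /eqP.
Qed.

End PureExtension.

(** The gcd over [K] is not constant, because [a] remains a common root over [L]. Irreducible
    annihilators can thus be used as minimal polynomials. *)
Lemma irreducible_dvd_root (K L : fieldType) (iota : {rmorphism K -> L})
    (f P : {poly K}) (a : L) :
  irreducible_poly f -> root (map_poly iota f) a -> root (map_poly iota P) a ->
  f %| P.
Proof.
move=> irr fa Pa; suff : gcdp f P %= f.
  by move=> e; rewrite -(eqp_dvdl _ e) dvdp_gcdr.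
apply: irr; last exact: dvdp_gcdl.
apply: contraTneq (fa) => s1; have [q q0 e] := size_poly1P _ (introT eqP s1).
have : root (map_poly iota (gcdp f P)) a by rewrite gcdp_map root_gcd fa Pa.
by rewrite e map_polyC rootC fmorph_eq0 (negPf q0).
Qed.

Lemma coprime_multiple (i q p : nat) :
  (0 < q)%N -> (0 < p)%N -> coprime q p ->
  exists j l, (i + q * j = p * l)%N.
Proof.
move=> q0; case: p => // p _ /eqP cop; case: (egcdnP p.+1 q0) => u v.
(* Here [p] is the predecessor of the modulus, so the factor [p] in the first witness acts as [-1]
   modulo [p.+1]. *)
rewrite cop => e _; exists (i * u * p)%N, (i * (v * p + 1))%N.
transitivity (i + i * p * (u * q))%N; first by lia.
by rewrite e; lia.
Qed.

Section Step.
Variables (K L : fieldType) (iota : {rmorphism K -> L}).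
Variables (n : nat) (a : L) (c : K).
Let p := n.+1.
Hypotheses (p_prime : prime p) (p_unit : p%:R != 0 :> K).
Hypothesis sqrtN1 : exists i : K, i ^+ 2 = -1.
Hypotheses (ac : a ^+ p = iota c) (nc : forall y, c <> y ^+ p).

(** This is the group generated by [a] and [K^*]; natural exponents suffice because [a ^+ p] lies in
    [K]. *)
Definition radical_powers (x : L) : Prop :=
  exists i : nat, exists2 g : K, g != 0 & x = a ^+ i * iota g.

Let f := 'X^p - c%:P.
Let ev (P : {poly K}) := (map_poly iota P).[a].

Let p_gt0 : (0 < p)%N. Proof. by []. Qed.

Let c_neq0 : c != 0.
Proof. by apply/negP => /eqP c0; apply: (nc (y := 0)); rewrite c0 expr0n. Qed.

Lemma radical_neq0 : a != 0.
Proof. by apply/eqP => a0; move: (fmorph_eq0 iota c);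
  rewrite -ac a0 expr0n eqxx (negPf c_neq0). Qed.
Let a_neq0 := radical_neq0.

Lemma radical_powersM x y :
  radical_powers x -> radical_powers y -> radical_powers (x * y).
Proof.
move=> [i [g g0 ->]] [j [h h0 ->]]; exists (i + j)%N; exists (g * h).
  by rewrite mulf_neq0.
by rewrite rmorphM exprD mulrACA.
Qed.

Lemma radical_powersV x : radical_powers x -> radical_powers x^-1.
Proof.
move=> [i [g g0 ->]]; exists (i * n)%N; exists (g^-1 / c ^+ i).
  by rewrite mulf_neq0 ?invr_eq0 ?expf_neq0.
have e : iota (c ^+ i) = a ^+ (i * n) * a ^+ i.
  by rewrite rmorphXn /= -ac -exprM -exprD mulnC mulnS addnC.
rewrite fmorph_div fmorphV e !(@invfM L) [RHS]mulrCA [LHS]mulrC; congr (_ * _).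
by rewrite mulVKf ?expf_neq0 ?a_neq0.
Qed.

Lemma radical_powers_scalar g : g != 0 -> radical_powers (iota g).
Proof. by move=> g0; exists 0%N; exists g; rewrite ?mul1r. Qed.

Lemma radical_powersX i : radical_powers (a ^+ i).
Proof. by exists i; exists 1; rewrite ?oner_neq0 ?rmorph1 ?mulr1. Qed.

Lemma radical_root : root (map_poly iota f) a.
Proof.
by rewrite rootE rmorphB rmorphXn /= map_polyX map_polyC !hornerE ac subrr.
Qed.

Lemma radical_dvd P : ev P = 0 -> f %| P.
Proof.
move=> /eqP P0; apply: irreducible_dvd_root radical_root P0.
exact: irreducible_XnsubC.
Qed.

Let evM P Q : ev (P * Q) = ev P * ev Q.
Proof. by rewrite /ev rmorphM hornerM. Qed.
Let evC k : ev k%:P = iota k.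
Proof. by rewrite /ev map_polyC hornerC. Qed.
Let evX i : ev ('X^i) = a ^+ i.
Proof. by rewrite /ev map_polyXn hornerXn. Qed.
Let evXn P i : ev (P ^+ i) = ev P ^+ i.
Proof. by rewrite /ev rmorphXn horner_exp. Qed.

(** The determinant is the norm of [a], which equals [c] up to a sign. The sign is a [p]-th power:
    trivially for odd [p], and thanks to [sqrtN1] for [p = 2]. *)
Lemma norm_radical (A : 'M[K]_p) : char_poly A = f -> exists e, \det A = e ^+ p * c.
Proof.
move=> cA; have := char_poly_det A; rewrite cA coefB coefXn coefC /= sub0r.
move/(congr1 (fun x => (-1) ^+ p * x)); rewrite mulrA -exprD addnn -mul2n exprM.
rewrite sqrrN expr1n expr1n mul1r => <-.
suff [e ee] : exists e : K, e ^+ p = -1.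
  by exists (-1 * e); rewrite exprMn ee mulrN1 mulrN mulNr.
case: sqrtN1 => i i2; have [p2 | op] := even_prime p_prime; first by exists i;
  rewrite p2.
by exists (-1); rewrite -signr_odd op.
Qed.

(* The two cases compare norms, respectively traces, from K(a) to K. *)
Lemma radical_root_mem q P i k : prime q -> ev P != 0 -> k != 0 ->
  ev P ^+ q = a ^+ i * iota k ->
  exists2 y, radical_powers y & ev P ^+ q = y ^+ q.
Proof.
move=> qp P0 k0 Pq.
have [A cA] : exists A : 'M[K]_p, char_poly A = f.
  by apply: companion_exists; rewrite ?monicXnsubC ?size_XnsubC.
(* [f] is the minimal polynomial of [a], so the value of a polynomial at [A] depends only on its
   value at [a]. Identities in [K(a)] become identities between matrices. *)
have hA Q R : ev Q = ev R -> horner_mx A Q = horner_mx A R.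
  move=> e; apply/subr0_eq; rewrite -rmorphB; apply: horner_mx_eq0_dvd.
  rewrite cA; apply: radical_dvd.
  by rewrite /ev rmorphB hornerD hornerN -/(ev Q) e subrr.
have Ap : A ^+ p = c%:M.
  apply/eqP; rewrite -subr_eq0 -horner_mx_XnsubC; apply/eqP.
  by apply: horner_mx_eq0_dvd; rewrite cA.
have [e detA] := norm_radical cA.
have cop_not k' x : coprime k' p -> c ^+ k' = x ^+ p -> False.
  move=> cop ck; have [k'0 | k'0] := posnP k'.
    by move: cop p_prime; rewrite k'0 /coprime gcd0n => /eqP ->.
  by have [y /nc] := root_of_coprime_exp k'0 p_gt0 cop ck.
(* If multiplication by [a ^+ j] makes the [q]-th power equal to [g ^+ q] with [g] in [K], then
   [y = g / a ^+ j] works. The cases that do not end in a contradiction look for such a [j]. *)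
have red Q j d : ev (Q * 'X^j) ^+ q = iota d -> d != 0 -> (exists g, d = g ^+ q) ->
    exists2 y, radical_powers y & ev Q ^+ q = y ^+ q.
  move=> Qd d0 [g dg]; exists ((a ^+ j)^-1 * iota g).
    apply: radical_powersM; first exact/radical_powersV/radical_powersX.
    apply: radical_powers_scalar; apply: contraNneq d0 => g0.
    by rewrite dg g0 expr0n eqn0Ngt prime_gt0.
  rewrite exprMn -rmorphXn /= -dg -Qd -exprMn evM evX mulrC mulfK //.
  by rewrite expf_neq0.
have [qp_eq | qNp] := eqVneq q p; last first.
  have cop : coprime q p by rewrite prime_coprime // dvdn_prime2.
  (* Choosing [j] with [p] dividing [i + q * j] puts the new [q]-th power in [K]. Taking
     determinants, its own [p]-th power is a [q]-th power, and [p], [q] are coprime. *)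
  have [j [l jl]] := coprime_multiple i (prime_gt0 qp) p_gt0 cop.
  have Qd : ev (P * 'X^j) ^+ q = iota (c ^+ l * k).
    rewrite evM evX exprMn Pq mulrAC -exprM -exprD [(j * q)%N]mulnC jl exprM ac.
    by rewrite rmorphM rmorphXn.
  apply: (red P j _ Qd); first by rewrite mulf_neq0 ?expf_neq0.
  have := hA (( P * 'X^j) ^+ q) (c ^+ l * k)%:P; rewrite evXn evC => /(_ Qd).
  move/(congr1 determinant); rewrite rmorphXn /= det_expmx horner_mx_C det_scalar.
  move/esym/root_of_coprime_exp; apply=> //; rewrite ?prime_gt0 //.
  by rewrite coprime_sym.
(* When [q = p] does not divide [i], comparing norms would make [c ^+ i], hence [c], a [p]-th
   power. *)
subst q; have [pi | pNi] := boolP (p %| i)%N; last first.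
  have := hA (P ^+ p) ('X^i * k%:P); rewrite evXn evM evX evC => /(_ Pq).
  move/(congr1 determinant).
  rewrite rmorphM !rmorphXn /= horner_mx_X det_expmx -mulmxE det_mulmx det_expmx.
  rewrite horner_mx_C det_scalar detA exprMn => e1.
  have e0 : e ^+ p != 0.
    have : \det A ^+ p != 0.
      by rewrite -det_expmx Ap det_scalar expf_neq0.
    by rewrite detA exprMn mulf_eq0 negb_or => /andP[]; rewrite expf_eq0 /= => ? _.
  case: (@cop_not i (\det (horner_mx A P) / (e ^+ i * k))).
    by rewrite coprime_sym prime_coprime.
  rewrite expr_div_n e1 exprMn [(e ^+ i) ^+ p]exprAC invfM mulrACA mulfV
    ?expf_neq0 //.
  by rewrite mulr1 mulrAC divff ?mul1r // expf_neq0.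
have {}Pq : ev P ^+ p = iota (c ^+ (i %/ p) * k).
  by rewrite Pq rmorphM rmorphXn /= -ac -exprM mulnC divnK.
set d := c ^+ _ * k in Pq; have d0 : d != 0 by rewrite mulf_neq0 ?expf_neq0.
have [R [eR sR]] : exists R : {poly K}, ev R = ev P /\ (size R <= p)%N.
  exists (P %% f); split.
    rewrite [in RHS](divp_eq P f) /ev [in RHS]rmorphD hornerD [in RHS]rmorphM
      hornerM.
    by move: radical_root; rewrite rootE => /eqP ->; rewrite mulr0 add0r.
  by rewrite -ltnS -(size_XnsubC c p_gt0) ltn_modp -size_poly_gt0 size_XnsubC.
rewrite -eR in P0 Pq.
have R0 : R != 0 by apply: contraNneq P0 => ->; rewrite /ev rmorph0 horner0.
(* With [j] the degree of the reduced polynomial [R], the factor [a ^+ (p - j)] moves the leading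
   term to [a ^+ p = c], the only term with nonzero trace. If [d * c ^+ (p - j)] were not a [p]-th
   power, the total trace would vanish, yet it is [p] times the leading coefficient times [c]. *)
set j := (size R).-1.
have jp : (j < p)%N by rewrite (leq_trans _ sR) // prednK // size_poly_gt0.
have Rj : R`_j != 0 by rewrite -lead_coefE lead_coef_eq0.
have Qd : ev (R * 'X^(p - j)) ^+ p = iota (d * c ^+ (p - j)).
  by rewrite evM evX exprMn Pq exprAC ac rmorphM rmorphXn.
have dc0 : d * c ^+ (p - j) != 0 by rewrite mulf_neq0 ?expf_neq0.
case: (pselect (exists g, d * c ^+ (p - j) = g ^+ p)) => [dg | ndg].
  by rewrite -eR; apply: red Qd dc0 dg.
have trX m : ~~ (p %| m)%N -> \tr (A ^+ m) = 0.
  move=> pm; apply: (@trace_root_scalar _ _ _ (c ^+ m)) => // [y cy|].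
    by apply: (@cop_not m y); rewrite // coprime_sym prime_coprime.
  by rewrite -exprM mulnC exprM Ap -rmorphXn.
have : \tr (horner_mx A (R * 'X^(p - j))) = 0.
  apply: (@trace_root_scalar _ _ _ (d * c ^+ (p - j))) => // [y cy|].
    by apply: ndg; exists y.
  by rewrite -rmorphXn /= -(horner_mx_C A); apply: hA; rewrite evXn evC.
rewrite rmorphM rmorphXn /= horner_mx_X -mulmxE.
rewrite -{1}(coefK R) poly_def rmorph_sum mulmx_suml raddf_sum /=.
have jR : (j < size R)%N by rewrite prednK // size_poly_gt0.
rewrite (bigD1 (Ordinal jR)) //= big1 => [|m mj].
  rewrite linearZ /= -scalemxAl rmorphXn /= horner_mx_X mulmxE -exprD subnKC;
    last exact: ltnW.
  rewrite Ap addr0 linearZ /= mxtrace_scalar => /eqP;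
    rewrite mulf_eq0 (negPf Rj) /=.
  by rewrite -mulr_natr mulf_eq0 (negPf c_neq0) (negPf p_unit).
rewrite linearZ /= -scalemxAl rmorphXn /= horner_mx_X mulmxE -exprD linearZ /=
  trX ?mulr0 //.
have mp : (m < p)%N by apply: leq_trans (ltn_ord m) sR.
apply: contra mj => pm; rewrite -val_eqE /=.
have : (m = j %[mod p])%N.
  apply/eqP; rewrite -(eqn_modDr (p - j)) subnKC ?modnn; last exact: ltnW.
  exact: pm.
by rewrite !modn_small // => /eqP.
Qed.

End Step.

(** * Subgroups of the multiplicative group *)

Section Range.
Variables (K L : fieldType) (iota : {rmorphism K -> L}).

Lemma range1 : range iota 1. Proof. by exists 1; rewrite ?rmorph1. Qed.
Lemma range0 : range iota 0. Proof. by exists 0; rewrite ?rmorph0. Qed.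
Lemma rangeM x y : range iota x -> range iota y -> range iota (x * y).
Proof. by move=> [u _ <-] [v _ <-]; exists (u * v); rewrite ?rmorphM. Qed.
Lemma rangeD x y : range iota x -> range iota y -> range iota (x + y).
Proof. by move=> [u _ <-] [v _ <-]; exists (u + v); rewrite ?rmorphD. Qed.
Lemma rangeN x : range iota x -> range iota (- x).
Proof. by move=> [u _ <-]; exists (- u); rewrite ?rmorphN. Qed.
Lemma rangeV x : range iota x -> range iota x^-1.
Proof. by move=> [u _ <-]; exists u^-1; rewrite ?fmorphV. Qed.
Lemma rangeX x n : range iota x -> range iota (x ^+ n).
Proof. by move=> [u _ <-]; exists (u ^+ n); rewrite ?rmorphXn. Qed.
Lemma range_div x y : range iota x -> range iota y -> range iota (x / y).
Proof. by move=> xF yF; apply: rangeM => //; apply: rangeV. Qed.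

Lemma range_sum (I : Type) (r : seq I) (P : pred I) (F : I -> L) :
  (forall i, P i -> range iota (F i)) -> range iota (\sum_(i <- r | P i) F i).
Proof. by move=> hF; apply: big_ind => //; [exact: range0 | exact: rangeD]. Qed.

Lemma range_divC x y : range iota (x / y) -> range iota (y / x).
Proof. by move/rangeV; rewrite invf_div. Qed.

Lemma range_div_trans y x z : y != 0 ->
  range iota (x / y) -> range iota (y / z) -> range iota (x / z).
Proof. by move=> y0 h /(rangeM h); rewrite mulrA mulfVK. Qed.

Lemma nonzero_rangeP x : nonzero (range iota) x <-> range iota x /\ x != 0.
Proof. by split=> -[h1 h2]; split=> //; apply/eqP. Qed.

End Range.

Section Subgroups.
Variables (L : fieldType) (H : set L).
Hypothesis sgH : mul_subgroup H.

Lemma mul_subgroup_neq0 x : H x -> x != 0.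
Proof. by case: sgH => h0 _; apply: contraPneq => ->. Qed.

Lemma mul_subgroup1 : H 1.
Proof. by case: sgH => _ [/set_mem]. Qed.

Lemma mul_subgroup_div x y : H x -> H y -> H (x / y).
Proof. by case: sgH => _ [_ h] /mem_set hx /mem_set hy; apply/set_mem/h. Qed.

Lemma mul_subgroupV x : H x -> H x^-1.
Proof. by rewrite -div1r; apply: mul_subgroup_div mul_subgroup1. Qed.

Lemma mul_subgroupM x y : H x -> H y -> H (x * y).
Proof. by rewrite -{2}[y]invrK => hx /mul_subgroupV; apply: mul_subgroup_div. Qed.

Lemma mul_subgroupX x n : H x -> H (x ^+ n).
Proof.
move=> hx; elim: n => [|n IHn]; rewrite ?expr0; first exact: mul_subgroup1.
by rewrite exprS; apply: mul_subgroupM.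
Qed.

End Subgroups.

Lemma mul_subgroupI (L : fieldType) (H : set L) : (forall x, H x -> x != 0) ->
  H 1 -> (forall x y, H x -> H y -> H (x / y)) -> mul_subgroup H.
Proof.
move=> h0 h1 hd; split; first by move/h0; rewrite eqxx.
by split=> [|x y /set_mem hx /set_mem hy]; apply/mem_set => //; apply: hd.
Qed.

Lemma nonzero_range_subgroup (K L : fieldType) (iota : {rmorphism K -> L}) :
  mul_subgroup (nonzero (range iota)).
Proof.
apply: mul_subgroupI => [x /nonzero_rangeP[] //||x y /nonzero_rangeP[Fx x0]
  /nonzero_rangeP[Fy y0]].
  by apply/nonzero_rangeP; rewrite oner_neq0; split=> //; exact: range1.
by apply/nonzero_rangeP; rewrite mulf_neq0 ?invr_eq0 //; split=> //;
  exact: range_div.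
Qed.

Section MulSet.
Variables (L : fieldType) (A B : set L).
Hypotheses (sgA : mul_subgroup A) (sgB : mul_subgroup B).

Lemma mul_set_subgroup : mul_subgroup (mul_set A B).
Proof.
apply: mul_subgroupI.
- move=> _ [a Aa [b Bb <-]].
  by rewrite mulf_neq0 ?(mul_subgroup_neq0 sgA Aa) ?(mul_subgroup_neq0 sgB Bb).
- by exists 1; [exact: mul_subgroup1 | exists 1; rewrite ?mulr1 //;
  exact: mul_subgroup1].
- move=> _ _ [a Aa [b Bb <-]] [c Ac [d Bd <-]].
  exists (a / c); first exact: mul_subgroup_div.
  by exists (b / d); [exact: mul_subgroup_div | rewrite mulf_div].
Qed.

Lemma mul_set_subl : A `<=` mul_set A B.
Proof. by move=> a Aa; exists a => //; exists 1; rewrite ?mulr1 //;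
  exact: mul_subgroup1. Qed.

Lemma mul_set_subr : B `<=` mul_set A B.
Proof. by move=> b Bb; exists 1; [exact: mul_subgroup1 | exists b;
  rewrite ?mul1r]. Qed.
End MulSet.

(** * Kneser's theorem *)

Section Independence.
Variable L : fieldType.
Implicit Types (F H : set L) (s : seq L).

Definition inequiv F (x y : L) := ~~ `[< F (x / y) >].

(* When F is a field and H contains its nonzero elements, this says that
   representatives of the cosets of H modulo F are linearly independent over F. *)
Definition sum_free F H := forall s,
  (forall x, x \in s -> H x) -> pairwise (inequiv F) s ->
  \sum_(x <- s) x = 0 -> s = [::].

Lemma inequivP F x y : reflect (~ F (x / y)) (inequiv F x y).
Proof. by apply: (iffP idP) => /asboolPn. Qed.
End Independence.

Section Grouping.
Variables (L K1 : fieldType) (iota1 : {rmorphism K1 -> L}) (F H : set L).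
Let F1 := range iota1.
Hypothesis sgH : mul_subgroup H.
Hypothesis sfF : sum_free F (H `&` F1).
Let H1 := mul_set H (nonzero F1).

(** Deduces freeness over [F] from freeness over the larger field [F1]. Terms are merged along their
    classes modulo [F1]; divided by one of its terms, a class sum becomes a sum of elements of [H]
    in [F1], pairwise inequivalent modulo [F], hence nonzero by [sfF]. *)
Lemma group_sum s :
  (forall x, x \in s -> H x) -> pairwise (inequiv F) s ->
  exists s1, [/\ forall y, y \in s1 -> H1 y, pairwise (inequiv F1) s1,
    \sum_(x <- s) x = \sum_(y <- s1) y, s1 = [::] -> s = [::] &
    forall y, y \in s1 -> exists2 x, x \in s & F1 (y / x)].
Proof.
elim: {s}(size s).+1 {-2}s (ltnSn (size s)) => // n IHn [|x t] sn sH ps.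
  by exists [::]; split=> //.
pose e y := `[< F1 (y / x) >].
have Hx : H x by apply: sH; rewrite mem_head.
have x0 := mul_subgroup_neq0 sgH Hx.
have ex : e x by apply/asboolP; rewrite divff //; exact: range1.
have /IHn[]: (size (filter (predC e) t) < n)%N.
  by rewrite size_filter (leq_ltn_trans (count_size _ _)).
- by move=> y; rewrite mem_filter => /andP[_ yt]; apply: sH; rewrite inE yt orbT.
- by move: ps => /= /andP[_]; apply: pairwise_filter.
move=> s1 [s1H p1 sum1 _ s1e].
set u := filter e (x :: t).
have uH y : y \in u -> H y /\ F1 (y / x).
  by rewrite mem_filter => /andP[/asboolP ey /sH].
set y0 := \sum_(y <- u) y.
have y0x : y0 / x = \sum_(y <- [seq y / x | y <- u]) y by rewrite big_map mulr_suml.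
have F1y0 : F1 (y0 / x).
  rewrite y0x big_map big_seq; apply: range_sum => y /uH[]//.
have y00 : y0 / x != 0.
  apply/eqP => y0x0; suff : [seq y / x | y <- u] = [::] by rewrite /u /= ex.
  apply: sfF; last by rewrite -y0x.
    by move=> _ /mapP[z /uH[Hz Fz] ->]; split=> //; exact: mul_subgroup_div.
  rewrite pairwise_map; apply: sub_pairwise (pairwise_filter e ps) => y z.
  by rewrite /inequiv /= invf_div mulrA mulfVK.
have y0_neq0 : y0 != 0 by apply: contraNneq y00 => ->; rewrite mul0r.
exists (y0 :: s1); split=> //.
- move=> y; rewrite inE => /predU1P[->|/s1H//].
  exists x => //; exists (y0 / x); last by rewrite mulrC mulfVK.
  by apply/nonzero_rangeP.
- rewrite /= p1 andbT; apply/allP => y ys1; have [z] := s1e y ys1;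
  rewrite mem_filter => /andP[ez zt] Fyz.
  apply/inequivP => Fy0; move/asboolP: ez; apply.
  have z0 : z != 0 by apply/(mul_subgroup_neq0 sgH)/sH; rewrite inE zt orbT.
  have y_0 : y != 0.
    apply: (mul_subgroup_neq0 _ (s1H y ys1)).
    exact: mul_set_subgroup sgH (nonzero_range_subgroup _).
  apply: (range_div_trans y0_neq0) F1y0.
  apply: (range_div_trans y_0); apply: range_divC => //.
- rewrite [RHS]big_cons -sum1 /y0 /u !big_filter (bigID e) /=; congr (_ + _).
  by rewrite big_cons ex.
- move=> y; rewrite inE => /predU1P[->|/s1e[z]]; first by exists x;
  rewrite ?mem_head.
  by rewrite mem_filter => /andP[_ zt]; exists z; rewrite // inE zt orbT.
Qed.
End Grouping.

(** Realises [K(a)] as a field type embedded in [L], so that results quantified over a field and its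
    embedding apply to it. Any nonzero annihilator of [a] will do. *)
Lemma range_subfx_inj (K L : fieldType) (iota : {rmorphism K -> L}) (a : L)
    (f : {poly K}) : f != 0 -> root (map_poly iota f) a ->
  range (subfx_inj : subFExtend iota a f -> L) =
    [set (map_poly iota P).[a] | P in setT].
Proof.
move=> f0 fa; apply/seteqP; split=> x.
  move=> [y _ <-]; have [P ->] := subfxE y.
  by exists P; rewrite ?subfx_inj_eval.
by move=> [P _ <-]; exists (subfx_eval iota a f P); rewrite ?subfx_inj_eval.
Qed.

Lemma unity_root_pow (L : fieldType) (q : nat) (w x : L) :
  prime q -> w ^+ q = 1 -> w != 1 -> x ^+ q = 1 -> exists i, x = w ^+ i.
Proof.
move=> qp wq w1 xq.
have [m mw] : {m | m.-primitive_root w & (m %| q)%N}.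
  by apply: prim_order_exists; rewrite ?prime_gt0.
move=> /(prime_nt_dvdP qp) mq; have {}mq : m = q.
  by apply: mq; apply: contraNneq w1 => m1; move: mw (prim_expr_order mw);
    rewrite m1 expr1 => _ ->.
rewrite mq in mw; have /(prim_rootP mw) [i ->] := xq.
by exists i.
Qed.

Section KneserStep.
Variables (K L : fieldType) (iota : {rmorphism K -> L}).
Variables (n : nat) (a : L) (c : K).
Let p := n.+1.
Hypotheses (p_prime : prime p) (p_unit : p%:R != 0 :> K).
Hypothesis sqrtN1 : exists i : K, i ^+ 2 = -1.
Hypotheses (ac : a ^+ p = iota c) (nc : forall y, c <> y ^+ p).
Let f := 'X^p - c%:P.
Let F := range iota.
Let F1 := [set (map_poly iota P).[a] | P in [set: {poly K}]].

Variable (H : set L).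
Hypotheses (sgH : mul_subgroup H) (FH : nonzero F `<=` H) (Ha : H a).
Hypothesis torsH : forall x, H x -> exists m, [/\ (0 < m)%N & F (x ^+ m)].
Hypothesis rootH : forall q x, prime q -> H x -> x ^+ q = 1 -> F x.

Let rp := radical_powers iota a.

Lemma radical_sub_extension x : F x -> F1 x.
Proof. by move=> [k _ <-]; exists k%:P; rewrite // map_polyC hornerC. Qed.

Lemma radical_powers_group x : rp x -> H x.
Proof.
move=> [i [g g0 ->]]; apply: mul_subgroupM => //; first exact: mul_subgroupX.
by apply: FH; apply/nonzero_rangeP; rewrite fmorph_eq0; split=> //; exists g.
Qed.

Lemma extensionX x m : F1 x -> F1 (x ^+ m).
Proof. by move=> [P _ <-]; exists (P ^+ m); rewrite // rmorphXn horner_exp. Qed.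

Lemma radical_root_dec q x : prime q -> F1 x -> rp (x ^+ q) ->
  exists2 y, rp y & x ^+ q = y ^+ q.
Proof.
move=> qp [P _ <-] [i [k k0 Pq]].
apply: (radical_root_mem p_prime p_unit sqrtN1 ac nc qp _ k0 Pq).
have : a ^+ i * iota k != 0.
  by rewrite mulf_neq0 ?fmorph_eq0 // expf_neq0 // (mul_subgroup_neq0 sgH Ha).
by rewrite -Pq; apply: contraNneq => ->; rewrite expr0n eqn0Ngt prime_gt0.
Qed.

(** Primes are peeled off an exponent [m] with [x ^+ m] in [K]. By [radical_root_dec], the [q]-th
    power of [x ^+ m'] is [y ^+ q] for some [y] generated by [a] and [K^*]; the quotient is a [q]-th
    root of unity in [H], hence in [K]. *)
Lemma group_inter_extension x : H x -> F1 x -> rp x.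
Proof.
move=> Hx Fx; have [m [m0]] := torsH Hx.
have x0 := mul_subgroup_neq0 sgH Hx.
case=> k _ km; have : rp (x ^+ m).
  rewrite -km; apply: radical_powers_scalar.
  by rewrite -(fmorph_eq0 iota) km expf_neq0.
elim/ltn_ind: m m0 {km} => m IHm m0.
have [m1 | m1] := leqP m 1.
  by have -> : m = 1%N by lia.
have qp := pdiv_prime m1; rewrite -{1}(divnK (pdiv_dvd m)) exprM.
set q := pdiv m in qp *; set m' := (m %/ q)%N => xq.
have m'0 : (0 < m')%N by rewrite divn_gt0 ?(prime_gt0 qp) // pdiv_leq.
apply: (IHm m') => //; first by rewrite ltn_Pdiv ?(prime_gt1 qp).
have [y ry xy] := radical_root_dec qp (extensionX m' Fx) xq.
have y0 := mul_subgroup_neq0 sgH (radical_powers_group ry).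
rewrite -(mulfVK y0 (x ^+ m')); apply: radical_powersM => //.
have : F (x ^+ m' / y).
  apply: (rootH qp); first apply: mul_subgroup_div => //;
    first exact: mul_subgroupX.
    exact: radical_powers_group.
  by rewrite expr_div_n xy divff // expf_neq0.
case=> g _ gw; rewrite -gw; apply: radical_powers_scalar.
by rewrite -(fmorph_eq0 iota) gw mulf_neq0 ?invr_eq0 ?expf_neq0.
Qed.

(** Lets the induction of Kneser's theorem pass from [K] to [K(a)]. The factor [k] of [x = h * k] is
    [y] times a [q]-th root of unity [w], with [y] in [H]. If [w = 1] then [x] lies in [H], hence in
    [K]; otherwise [w] lies in [K(a)] and generates all [q]-th roots of unity. *)
Lemma extension_root q x : prime q -> mul_set H (nonzero F1) x -> x ^+ q = 1 ->
  F1 x.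
Proof.
move=> qp [h Hh [k [Fk /eqP k0] <-]] hkq; have h0 := mul_subgroup_neq0 sgH Hh.
have kq : k ^+ q = (h ^+ q)^-1.
  by apply: (mulfI (expf_neq0 q h0)); rewrite -exprMn hkq mulfV ?expf_neq0.
have [y ry ky] : exists2 y, rp y & k ^+ q = y ^+ q.
  apply: radical_root_dec => //; apply: group_inter_extension.
    by rewrite kq; apply: mul_subgroupV => //; exact: mul_subgroupX.
  exact: extensionX.
have Hy := radical_powers_group ry; have y0 := mul_subgroup_neq0 sgH Hy.
have wq : (k / y) ^+ q = 1 by rewrite expr_div_n ky divff // expf_neq0.
have [w1 | w1] := eqVneq (k / y) 1.
  apply: radical_sub_extension; apply: (rootH qp) hkq.
  by apply: mul_subgroupM => //; rewrite -(mulfVK y0 k) w1 mul1r.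
have [i ->] := unity_root_pow qp wq w1 hkq.
apply: extensionX; case: (radical_powersV ac nc ry) => j [g _ ->].
case: Fk => P _ <-; exists (P * ('X^j * g%:P)) => //.
by rewrite !rmorphM /= !hornerM map_polyXn map_polyC hornerXn hornerC.
Qed.

(** The terms have the form [a ^+ i * g] with [i < p] and [g] in [K^*], and inequivalent terms have
    different [i]. A vanishing sum is a polynomial of degree below [p] vanishing at [a], hence the
    zero polynomial. *)
Lemma sum_free_radical : sum_free F (H `&` F1).
Proof.
move=> s sH ps s0.
have {}sH x : x \in s -> rp x by move=> /sH[]; exact: group_inter_extension.
have a0 := mul_subgroup_neq0 sgH Ha.
have [P [sP Ps Pi P0]] : exists P : {poly K}, [/\ (size P <= p)%N,
    (map_poly iota P).[a] = \sum_(x <- s) x,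
    forall i, P`_i != 0 -> exists2 x, x \in s & F (x / a ^+ i) &
    P = 0 -> s = [::] ].
  elim: s sH ps {s0} => [|x t IHt] sH /= => [_|/andP[xt pt]].
    exists 0; rewrite size_poly0 rmorph0 horner0 big_nil; split=> // i.
    by rewrite coef0 eqxx.
  have [|P [sP Pt Pi P0]] := IHt _ pt.
    by move=> y yt; apply: sH; rewrite inE yt orbT.
  have [i [g [ip g0 xg]]] : exists i g, [/\ (i < p)%N, g != 0 & x = a ^+ i * iota
    g].
    have [i [g g0 ->]] := sH x (mem_head _ _).
    exists (i %% p)%N, (c ^+ (i %/ p) * g); rewrite ltn_pmod // mulf_neq0 //.
      split=> //; rewrite rmorphM rmorphXn /= -ac mulrA; congr (_ * _).
      by rewrite -exprM -exprD addnC mulnC -divn_eq.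
    rewrite expf_neq0 // -(fmorph_eq0 iota) -ac expf_neq0 //.
  have Pi0 : P`_i = 0.
    apply/eqP/negPn/negP => /Pi[y yt Fy].
    have /inequivP := allP xt _ yt; apply.
    apply: (@range_div_trans _ _ _ (a ^+ i)); rewrite ?expf_neq0 //.
      by rewrite xg mulrC mulKf ?expf_neq0 //; exists g.
    exact: range_divC.
  exists (P + g *: 'X^i); split.
  - apply: leq_trans (size_polyD _ _) _; rewrite geq_max sP.
    by rewrite (leq_trans (size_scale_leq _ _)) // size_polyXn.
  - rewrite big_cons -Pt rmorphD /= hornerD addrC map_polyZ hornerZ map_polyXn
    hornerXn.
    by rewrite xg mulrC.
  - move=> j; rewrite coefD coefZ coefXn; have [->|ji] := eqVneq j i.
      by exists x; rewrite ?mem_head // xg mulrC mulKf ?expf_neq0 //; exists g.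
    by rewrite mulr0 addr0 => /Pi[y yt Fy]; exists y; rewrite // inE yt orbT.
  - move/(congr1 (fun Q : {poly K} => Q`_i)); rewrite coefD Pi0 coefZ coefXn eqxx.
    by rewrite add0r mulr1 coef0 => /eqP; rewrite (negPf g0).
apply: P0; apply/eqP; rewrite -size_poly_eq0 -leqn0 leqNgt size_poly_gt0;
  apply/negP => P0.
have /(dvdp_leq P0) : f %| P by apply: (radical_dvd p_prime ac nc); rewrite Ps.
by rewrite size_XnsubC // leqNgt ltnS sP.
Qed.

End KneserStep.

(* Induction on the size of t: adjoin to K an element of H of prime order modulo K. *)
Theorem kneser (L : fieldType) (n : nat) : forall (K : fieldType)
    (iota : {rmorphism K -> L}) (H : set L) (t : seq L),
  mul_subgroup H -> nonzero (range iota) `<=` H ->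
  (forall x, H x -> exists m, [/\ (0 < m)%N, m%:R != 0 :> L & range iota (x ^+
    m)]) ->
  (forall q x, prime q -> H x -> x ^+ q = 1 -> range iota x) ->
  (exists i : K, i ^+ 2 = -1) ->
  (forall y, y \in t -> H y) ->
  (forall x, H x -> exists2 y, y \in t & range iota (x / y)) ->
  (size t <= n)%N -> sum_free (range iota) H.
Proof.
elim: n => [|n IHn] K iota H t sgH FH torsH rootH i2 tH cov st.
  have [y] := cov 1 (mul_subgroup1 sgH).
  by move: st; rewrite leqn0 size_eq0 => /eqP ->.
case: (pselect (H `<=` range iota)) => [HF|].
  move=> [|x [|y s]] // sH.
    move=> _; rewrite big_seq1 => x0.
    by have := mul_subgroup_neq0 sgH (sH x (mem_head _ _)); rewrite x0 eqxx.
  rewrite /= => /andP[/andP[/inequivP xy _] _]; case: xy.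
  by apply: range_div; apply: HF; apply: sH; rewrite !inE eqxx ?orbT.
move=> /existsNP[b /not_implyP[Hb Fb]].
have [m [m0 mu bm]] := torsH b Hb.
have [p [a [pp pu Ha Fa Fap]]] : exists p a,
    [/\ prime p, p%:R != 0 :> L, H a, ~ range iota a & range iota (a ^+ p)].
  elim/ltn_ind: m m0 mu bm => m IHm m0 mu bm.
  have [m1 | m1] := leqP m 1.
    by case: Fb; move: bm; have -> : m = 1%N by lia.
  have pp := pdiv_prime m1; have m'p := divnK (pdiv_dvd m).
  case: (pselect (range iota (b ^+ (m %/ pdiv m)))) => [bm'|nb].
    apply: (IHm (m %/ pdiv m)%N) => //.
    - by rewrite ltn_Pdiv ?(prime_gt1 pp).
    - by rewrite divn_gt0 ?(prime_gt0 pp) // pdiv_leq.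
    - by apply: contraNneq mu => e; rewrite -m'p natrM e mul0r.
  exists (pdiv m), (b ^+ (m %/ pdiv m)); split=> //.
  - by apply: contraNneq mu => e; rewrite -m'p natrM e mulr0.
  - exact: mul_subgroupX.
  - by rewrite -exprM m'p.
case: Fap => c _ ac.
case: p => // k in pp pu ac *; have a0 := mul_subgroup_neq0 sgH Ha.
(* Otherwise [a / iota y] would be a root of unity of prime exponent in [H], hence in [K], and so
   would [a]. *)
have nc y : c <> y ^+ k.+1.
  move=> cy; apply: Fa; have y0 : iota y != 0.
    by apply: contraNneq a0 => y0; move: (expf_eq0 a k.+1);
      rewrite -ac cy rmorphXn /= y0 expr0n eqxx => <-.
  rewrite -(mulfVK y0 a); apply: rangeM; last by exists y.
  apply: rootH pp _ _.
    apply: mul_subgroup_div => //; apply: FH.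
    by apply/nonzero_rangeP; split=> //; exists y.
  by rewrite expr_div_n -ac cy rmorphXn divff // expf_neq0.
have pu' : k.+1%:R != 0 :> K by rewrite -(fmorph_eq0 iota) rmorph_nat.
have f0 : 'X^(k.+1) - c%:P != 0 by rewrite -size_poly_gt0 size_XnsubC.
have ac' : a ^+ k.+1 = iota c by [].
pose iota1 : {rmorphism subFExtend iota a ('X^(k.+1) - c%:P) -> L} :=
  subfx_inj.
have F1E := range_subfx_inj f0 (radical_root ac').
have torsH' x : H x -> exists m, [/\ (0 < m)%N & range iota (x ^+ m)].
  by move=> /torsH[m' [? _ ?]]; exists m'.
have FF1 x : range iota x -> range iota1 x.
  by rewrite F1E; apply: radical_sub_extension.
have aF1 : range iota1 a by rewrite F1E; exists 'X; rewrite // map_polyX hornerX.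
have sgF1 := nonzero_range_subgroup iota1.
have HH1 := mul_set_subl (A := H) sgF1.
have sf1 : sum_free (range iota1) (mul_set H (nonzero (range iota1))).
  have [y yt y1] := cov 1 (mul_subgroup1 sgH).
  have [y' y't ay'] := cov a Ha.
  have y_0 := mul_subgroup_neq0 sgH (tH y yt).
  have y'_0 := mul_subgroup_neq0 sgH (tH y' y't).
  have yy' : y != y'.
    apply: contra_notN Fa => /eqP e; rewrite -[a]divr1.
    by apply: (range_div_trans y'_0) ay' _; apply: range_divC; rewrite -e.
  apply: (IHn _ iota1 _ [seq z <- t | z != y']).
  - exact: mul_set_subgroup.
  - exact: mul_set_subr.
  - move=> _ [h /torsH[l [l0 lu hl]] [g [Fg g0] <-]]; exists l; split=> //.
    by rewrite exprMn; apply: rangeM; [exact: FF1 | exact: rangeX].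
  - move=> q x qp H1x xq; rewrite F1E.
    apply: (extension_root pp pu' i2 ac' nc sgH FH Ha torsH' rootH qp) xq.
    by rewrite -F1E.
  - case: i2 => i i2; exists (inj_subfx iota a ('X^(k.+1) - c%:P) i).
    by rewrite -rmorphXn i2 rmorphN1.
  - by move=> z; rewrite mem_filter => /andP[_ /tH]; exact: HH1.
  - move=> _ [h Hh [g [Fg /eqP g0] <-]]; have [z zt hz] := cov h Hh.
    have h0 := mul_subgroup_neq0 sgH Hh.
    have [e | zy'] := eqVneq z y'.
      exists y; first by rewrite mem_filter yy'.
      rewrite mulrAC; apply: rangeM => //.
      apply: (range_div_trans a0).
        by apply: FF1; apply: (range_div_trans y'_0); rewrite -?e //;
          apply: range_divC; rewrite e.
      by apply: rangeM => //; apply: FF1; rewrite -div1r.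
    exists z; first by rewrite mem_filter zy'.
    by rewrite mulrAC; apply: rangeM => //; exact: FF1.
  - rewrite -ltnS size_filter; apply: leq_trans st.
    rewrite -(count_predC (pred1 y') t) -[X in (X < _)%N]add0n ltn_add2r -has_count.
    by apply/hasP; exists y' => //=.
have sf0 : sum_free (range iota) (H `&` range iota1).
  by rewrite F1E; apply: (sum_free_radical pp pu' i2 ac' nc sgH FH Ha torsH' rootH).
move=> s sH ps s0.
have [s1 [s1H p1 sum1 s1s _]] := group_sum sgH sf0 sH ps.
by apply/s1s/(sf1 s1) => //; rewrite -sum1.
Qed.

(** * Conjugates in a cyclotomic extension *)

Lemma unity_root_neq0 (R : nzRingType) (p : nat) (w : R) :
  (0 < p)%N -> w ^+ p = 1 -> w != 0.
Proof.
move=> p0 wp; apply/eqP => w0; move/eqP: wp.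
by rewrite w0 expr0n eqn0Ngt p0 eq_sym oner_eq0.
Qed.

Lemma irreducible_annihilator (K L : fieldType) (iota : {rmorphism K ->
  L}) (x : L) p :
  p != 0 -> root (map_poly iota p) x ->
  exists2 m, irreducible_poly m & root (map_poly iota m) x.
Proof.
move=> p0 px.
pose T s := `[< exists q : {poly K}, [/\ q != 0, root (map_poly iota q) x & size
  q = s] >].
have exT : exists s, T s by exists (size p); apply/asboolP; exists p.
case: (ex_minnP exT) => s /asboolP[m [m0 mx sm]] min; exists m => //.
have minq q : q != 0 -> root (map_poly iota q) x -> (size m <= size q)%N.
  by move=> q0 qx; rewrite sm; apply: min; apply/asboolP; exists q.
split=> [|q sq qm].
  by rewrite -(size_map_poly iota); apply: root_size_gt1 mx; rewrite map_poly_eq0.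
rewrite -dvdp_size_eqp //.
have q0 : q != 0 by apply: contraTneq qm => ->; rewrite dvd0p.
have [r mE] := Pdiv.Field.dvdpP _ _ qm.
have r0 : r != 0 by apply: contraNneq m0 => r0; rewrite mE r0 mul0r.
rewrite eqn_leq dvdp_leq //=.
move: mx; rewrite mE rmorphM rootM => /orP[rx|]; last by rewrite -mE; exact: minq.
have := minq r r0 rx; rewrite mE size_mul //.
move: (sq : (size q != 1)%N); have : (0 < size q)%N by rewrite size_poly_gt0.
have : (0 < size r)%N by rewrite size_poly_gt0.
by move: (size r) (size q) => u v; lia.
Qed.

Section Cyclotomic.
Variables (K L : fieldType) (iota : {rmorphism K -> L}) (n : nat) (zeta : L).
Hypothesis zetaP : n.-primitive_root zeta.
Variable (m : {poly K}).
Hypotheses (m_irr : irreducible_poly m) (m_root : root (map_poly iota m) zeta).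

Definition simple_ext (x : L) : set L := [set (map_poly iota P).[x] | P in setT].
Let E := simple_ext zeta.
Let F := range iota.
Let ev c (P : {poly K}) := (map_poly iota P).[zeta ^+ c].

(** These exponents stand for the elements of the Galois group of [K(zeta)] over [K]. *)
Definition conjugate_exponent (c : nat) := root (map_poly iota m) (zeta ^+ c).
Let C := conjugate_exponent.

Let evM c P Q : ev c (P * Q) = ev c P * ev c Q.
Proof. by rewrite /ev rmorphM hornerM. Qed.
Let evXn c P i : ev c (P ^+ i) = ev c P ^+ i.
Proof. by rewrite /ev rmorphXn horner_exp. Qed.
Let evC c k : ev c k%:P = iota k.
Proof. by rewrite /ev map_polyC hornerC. Qed.
Let evX c : ev c 'X = zeta ^+ c.
Proof. by rewrite /ev map_polyX hornerX. Qed.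
Let ev_comp c d P : ev c (P \Po 'X^d) = ev (c * d) P.
Proof. by rewrite /ev map_comp_poly horner_comp map_polyXn hornerXn -exprM. Qed.

Let EP x : E x <-> exists P, x = ev 1 P.
Proof.
by split=> [[P _ <-]|[P ->]]; exists P; rewrite // /ev expr1.
Qed.

Let ev_eq c d P Q : C c -> C d -> ev c P = ev c Q -> ev d P = ev d Q.
Proof.
move=> Cc Cd e; apply/eqP; rewrite -subr_eq0.
have ed P' Q' d' : ev d' P' - ev d' Q' = ev d' (P' - Q').
  by rewrite /ev rmorphB hornerD hornerN.
have /(irreducible_dvd_root m_irr Cc)/Pdiv.Field.dvdpP[R RE] :
    root (map_poly iota (P - Q)) (zeta ^+ c).
  by rewrite rootE -/(ev c _) -ed e subrr.
by rewrite ed RE evM; move: Cd; rewrite /C /conjugate_exponent rootE => /eqP;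
  rewrite /ev => ->; rewrite mulr0.
Qed.

Let C1 : C 1. Proof. by rewrite /C /conjugate_exponent expr1. Qed.

(* The K-embedding of K(zeta) sending zeta to its conjugate zeta ^+ c; outside
   K(zeta) the value is junk. *)
Definition conj_exp (c : nat) (x : L) : L :=
  ev c (xget 0 [set P | ev 1 P = x]).

Let cjE c P : C c -> conj_exp c (ev 1 P) = ev c P.
Proof.
move=> Cc; rewrite /conj_exp; apply: (ev_eq C1 Cc).
exact: (@xgetPex _ 0 [set Q | ev 1 Q = ev 1 P] (ex_intro _ P erefl)).
Qed.

Lemma conj_expM c x y : C c -> E x -> E y ->
  conj_exp c (x * y) = conj_exp c x * conj_exp c y.
Proof. by move=> Cc /EP[P ->] /EP[Q ->]; rewrite -evM !cjE // evM. Qed.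

Lemma conj_exp_range c x : C c -> F x -> conj_exp c x = x.
Proof. by move=> Cc [k _ <-]; rewrite -{1}(evC 1) cjE // evC. Qed.

Lemma simple_extM x y : E x -> E y -> E (x * y).
Proof. by move=> /EP[P ->] /EP[Q ->]; apply/EP; exists (P * Q); rewrite evM. Qed.

Lemma simple_extX x i : E x -> E (x ^+ i).
Proof. by move=> /EP[P ->]; apply/EP; exists (P ^+ i); rewrite evXn. Qed.

Lemma simple_ext_range x : F x -> E x.
Proof. by move=> [k _ <-]; apply/EP; exists k%:P; rewrite evC. Qed.

Lemma simple_ext_gen : E zeta.
Proof. by apply/EP; exists 'X; rewrite evX. Qed.

Lemma conj_expX c x i : C c -> E x -> conj_exp c (x ^+ i) = conj_exp c x ^+ i.
Proof. by move=> Cc /EP[P ->]; rewrite -evXn !cjE // evXn. Qed.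

Lemma conj_exp_gen c i : C c -> conj_exp c (zeta ^+ i) = zeta ^+ i ^+ c.
Proof.
by move=> Cc; rewrite -{1}[zeta]expr1 -evX -evXn cjE // evXn evX exprAC.
Qed.

Lemma conj_exp_ext c x : C c -> E x -> E (conj_exp c x).
Proof.
move=> Cc /EP[P ->]; rewrite cjE //; apply/EP; exists (P \Po 'X^c).
by rewrite ev_comp mul1n.
Qed.

(** The extension is abelian: both composites send [zeta] to [zeta ^+ (c * d)]. *)
Lemma conj_exp_comm c d x : C c -> C d -> E x ->
  conj_exp c (conj_exp d x) = conj_exp d (conj_exp c x).
Proof.
move=> Cc Cd /EP[P ->]; rewrite !cjE // -[ev d P]/(ev (d) P).
have e c' : ev c' P = ev 1 (P \Po 'X^c') by rewrite ev_comp mul1n.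
by rewrite !e !cjE // !ev_comp mulnC.
Qed.

Lemma conj_exp_neq0 c x : C c -> E x -> x != 0 -> conj_exp c x != 0.
Proof.
move=> Cc /EP[P ->]; rewrite cjE //; apply: contraNneq => P0.
have e0 d : ev d 0 = 0 by rewrite -polyC0 evC rmorph0.
by rewrite (@ev_eq c 1 P 0) ?e0.
Qed.

Lemma simple_extV x : E x -> E x^-1.
Proof.
have m0 := irredp_neq0 m_irr.
have -> : E = range (subfx_inj : subFExtend iota zeta m -> L).
  by rewrite range_subfx_inj.
exact: rangeV.
Qed.

Lemma conj_expV c x : C c -> E x -> conj_exp c x^-1 = (conj_exp c x)^-1.
Proof.
move=> Cc Ex; have [->|x0] := eqVneq x 0.
  by rewrite invr0 conj_exp_range ?invr0 //; exact: range0.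
apply: (mulfI (conj_exp_neq0 Cc Ex x0)).
rewrite -conj_expM ?mulfV ?conj_exp_neq0 //; last exact: simple_extV.
by rewrite conj_exp_range //; exact: range1.
Qed.

(** Write [x = P(zeta)] with [deg P < deg m]. As [m] divides [X^n - 1], its roots are [deg m]
    distinct powers of [zeta], and [P - x] vanishes at all of them. So [P] is the constant [x]. *)
Lemma conj_exp_fixed x : E x -> (forall c, C c -> conj_exp c x = x) -> F x.
Proof.
move=> Ex fx.
have [P [sP Px]] : exists P : {poly K}, (size P < size m)%N /\ x = ev 1 P.
  have /EP[P ->] := Ex; exists (P %% m); split.
    by rewrite ltn_modp irredp_neq0.
  rewrite {1}(divp_eq P m) /ev rmorphD hornerD rmorphM hornerM expr1.
  by move: m_root; rewrite rootE => /eqP ->; rewrite mulr0 add0r.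
have n0 := prim_order_gt0 zetaP.
have : map_poly iota m %| \prod_(i <- index_iota 0 n) ('X - (zeta ^+ i)%:P).
  have -> : \prod_(i <- index_iota 0 n) ('X - (zeta ^+ i)%:P) = map_poly iota
    ('X^n - 1).
    by rewrite rmorphB rmorph1 /= map_polyXn (factor_Xn_sub_1 zetaP).
  rewrite dvdp_map; apply: (irreducible_dvd_root m_irr m_root).
  rewrite rmorphB rmorph1 /= map_polyXn rootE !hornerE.
  by rewrite (prim_expr_order zetaP) subrr.
case/dvdp_prod_XsubC => b mb; set s := mask b _ in mb.
have sn i : i \in s -> (i < n)%N by move=> /mem_mask; rewrite mem_index_iota.
have Cs i : i \in s -> C i.
  move=> si; rewrite /C /conjugate_exponent (eqp_root mb).
  rewrite -(big_map (fun i => zeta ^+ i) xpredT (fun y => 'X - y%:P)).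
  by rewrite root_prod_XsubC; apply/mapP; exists i.
pose rs := [seq zeta ^+ i | i <- s].
have urs : uniq rs.
  rewrite map_inj_in_uniq ?mask_uniq ?iota_uniq // => i j /sn ni /sn nj /eqP.
  by rewrite (eq_prim_root_expr zetaP) !modn_small // => /eqP.
pose Q := map_poly iota P - x%:P.
have Qrs : all (root Q) rs.
  apply/allP => _ /mapP[i /Cs Ci ->]; rewrite rootE hornerD hornerN hornerC.
  by rewrite -/(ev i P) -cjE // -Px fx // subrr.
have Q0 : Q = 0.
  apply/eqP/negPn/negP => Q0; have := max_poly_roots Q0 Qrs urs.
  rewrite size_map.
  have sm : size m = (size s).+1.
    by rewrite -(size_map_poly iota) (eqp_size mb) size_prod_XsubC.
  have /leq_ltn_trans h : (size Q <= maxn (size P) 1)%N.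
    rewrite (leq_trans (size_polyD _ _)) // size_polyN size_map_poly geq_max
      leq_maxl.
    by rewrite (leq_trans (size_polyC_leq1 _)) // leq_maxr.
  move=> sQ; have : (size s < maxn (size P) 1)%N by apply: leq_trans sQ _;
    rewrite -ltnS; exact: h.
  have : (1 < size m)%N by case: m_irr.
  by move: sP; rewrite sm; lia.
exists P`_0 => //; move/(congr1 (fun R : {poly L} => R`_0)): Q0.
by rewrite coefB coef_map coefC coef0 /= => /subr0_eq.
Qed.

(** With [g = gcdn c n], the conjugation kills [zeta ^+ (n %/ g) - 1]; being injective, it forces
    [zeta ^+ (n %/ g) = 1], so [g = 1]. *)
Lemma conjugate_exponent_coprime c : C c -> coprime c n.
Proof.
move=> Cc; have n0 := prim_order_gt0 zetaP.
set g := gcdn c n; have g0 : (0 < g)%N by rewrite gcdn_gt0 n0 orbT.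
have zg : zeta ^+ (n %/ g) = 1.
  have E1 : E (zeta ^+ (n %/ g)) by apply/simple_extX/simple_ext_gen.
  have : conj_exp c (zeta ^+ (n %/ g) - 1) = 0.
    have -> : zeta ^+ (n %/ g) - 1 = ev 1 ('X^(n %/ g) - 1).
      by rewrite /ev rmorphB rmorph1 /= map_polyXn !hornerE expr1.
    rewrite cjE // /ev rmorphB rmorph1 /= map_polyXn !hornerE -exprM.
    by rewrite muln_divCA_gcd exprM (prim_expr_order zetaP) expr1n subrr.
  move=> e; apply/subr0_eq/eqP; apply: contra_eqT e => /conj_exp_neq0; apply=> //.
  have -> : zeta ^+ (n %/ g) - 1 = ev 1 ('X^(n %/ g) - 1).
    by rewrite /ev rmorphB rmorph1 /= map_polyXn !hornerE expr1.
  by apply/EP; eexists.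
have : (n %| n %/ g)%N by rewrite (prim_order_dvd zetaP) zg.
move=> /dvdn_leq; rewrite divn_gt0 // dvdn_leq ?dvdn_gcdr // => /(_ isT).
move=> ng; apply/eqP; rewrite -/g; apply/eqP; rewrite eqn_leq g0 andbT leqNgt.
by apply/negP => g1; move: ng; rewrite leqNgt ltn_Pdiv.
Qed.

Lemma iter_conj_exp c k x : C c -> E x -> zeta ^+ (c ^ k) = zeta ->
  iter k (conj_exp c) x = x.
Proof.
move=> Cc /EP[P ->] zk.
suff -> : iter k (conj_exp c) (ev 1 P) = ev (c ^ k) P by rewrite /ev zk expr1.
elim: k {zk} => [|k IHk] /=; first by rewrite expn0.
have -> : iter k (conj_exp c) (ev 1 P) = ev 1 (P \Po 'X^(c ^ k)).
  by rewrite IHk ev_comp mul1n.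
by rewrite cjE // ev_comp expnS.
Qed.

(** A conjugation [sigma] multiplies [x] by a root of unity of [E], hence [x ^+ w] by some [k] in
    [K]. By Euler's theorem its iterate of order [totient n] is the identity, so
    [k ^+ totient n = 1], and [sigma] fixes [x ^+ (w * totient n)]. *)
Lemma torsion_exponent w x M : (0 < M)%N ->
  (forall y k, E y -> (0 < k)%N -> y ^+ k = 1 -> F (y ^+ w)) ->
  E x -> x != 0 -> F (x ^+ M) -> F (x ^+ (w * totient n)).
Proof.
move=> M0 hw Ex x0 Fx; rewrite exprM.
have Exw : E (x ^+ w) by exact: simple_extX.
apply: conj_exp_fixed; first exact: simple_extX.
move=> c Cc; rewrite conj_expX //.
set y := conj_exp c x / x.
have Ey : E y by apply: simple_extM; [exact: conj_exp_ext | exact: simple_extV].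
have [k _ kE] : F (y ^+ w).
  apply: (hw y M) => //; rewrite expr_div_n -conj_expX // conj_exp_range //.
  by rewrite divff // expf_neq0.
have cxw : conj_exp c (x ^+ w) = iota k * x ^+ w.
  by rewrite conj_expX // kE -exprMn mulfVK.
have it i : iter i (conj_exp c) (x ^+ w) = iota (k ^+ i) * x ^+ w.
  elim: i => [|i IHi] /=; first by rewrite expr0 rmorph1 mul1r.
  rewrite IHi conj_expM // ?cxw; last by apply: simple_ext_range; eexists.
  by rewrite conj_exp_range ?exprSr ?rmorphM ?mulrA //; eexists.
have := it (totient n); rewrite iter_conj_exp //; last first.
  by rewrite -(prim_expr_mod zetaP) Euler_exp_totient ?conjugate_exponent_coprime //
             (prim_expr_mod zetaP).
rewrite -{1}[x ^+ w]mul1r => /(mulIf (expf_neq0 w x0)) k1.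
by rewrite cxw exprMn -rmorphXn -k1 mul1r.
Qed.

(** [g x] records, for each [c < n], the position in [rs] of the [k]-th root of unity
    [conj_exp c x / x]. If these quotients agree for [x] and [y], then every conjugation fixes
    [x / y]. Entries at exponents that are not conjugate are junk and are not consulted. *)
Lemma torsion_finite_invariant k (rs : seq L) :
  (forall y, y ^+ k = 1 -> y \in rs) ->
  exists (T : finType) (g : L -> T), forall x y, E x -> E y -> x != 0 -> y != 0 ->
    F (x ^+ k) -> F (y ^+ k) -> g x = g y -> F (x / y).
Proof.
move=> rsP; exists {ffun 'I_n -> 'I_(size rs).+1}.
exists (fun x => [ffun c : 'I_n => inord (index (conj_exp c x / x) rs)]).
move=> x y Ex Ey x0 y0 Fx Fy /ffunP gxy.
have rsE c z : C c -> E z -> z != 0 -> F (z ^+ k) -> conj_exp c z / z \in rs.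
  move=> Cc Ez z0 Fz; apply: rsP.
  by rewrite expr_div_n -conj_expX // conj_exp_range // divff // expf_neq0.
apply: conj_exp_fixed; first by apply: simple_extM => //; exact: simple_extV.
move=> c Cc; have n0 := prim_order_gt0 zetaP.
have cn : zeta ^+ (c %% n) = zeta ^+ c := prim_expr_mod zetaP c.
have conj_mod z : conj_exp (c %% n) z = conj_exp c z by rewrite /conj_exp /ev cn.
have := gxy (Ordinal (ltn_pmod c n0)); rewrite !ffunE /= !conj_mod.
move/(congr1 val); rewrite /= !inordK ?ltnS ?index_size // => e.
have : conj_exp c x / x = conj_exp c y / y.
  by rewrite -[LHS](nth_index 0 (rsE c x Cc Ex x0 Fx)) e nth_index //; exact: rsE.
rewrite conj_expM ?conj_expV //; last exact: simple_extV.
have cy0 := conj_exp_neq0 Cc Ey y0.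
move/eqP; rewrite eqr_div // => /eqP h; apply/eqP.
by rewrite eqr_div // h mulrC.
Qed.

(* If sigma and tau commute, sigma y = xi y and tau acts on p-th roots of unity
   as w |-> w ^ c, then y ^ c / tau y is fixed by sigma; moreover tau y / y is a
   p-th root of unity, and c - 1 is prime to p when tau moves those roots. *)
Lemma radical_root_unity p w0 y : prime p -> (p %| n)%N -> w0 ^+ p = 1 -> ~ F w0 ->
  E y -> y != 0 -> F (y ^+ p) -> exists2 w, w ^+ p = 1 & F (y / w).
Proof.
move=> pp pn w01 Fw0 Ey y0 Fy.
have w0z i : (zeta ^+ (n %/ p)) ^+ (p * i) = 1.
  by rewrite -exprM mulnA divnK // exprM (prim_expr_order zetaP) expr1n.
set w1 := zeta ^+ (n %/ p) in w0z.
have Ew1 : E w1 by apply/simple_extX/simple_ext_gen.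
have w1p : w1 ^+ p = 1 by have := w0z 1%N; rewrite muln1.
have w1_neq1 : w1 != 1.
  rewrite -(prim_order_dvd zetaP); apply/negP => /dvdn_leq.
  rewrite divn_gt0 ?prime_gt0 // dvdn_leq ?(prim_order_gt0 zetaP) // => /(_ isT).
  by rewrite leqNgt ltn_Pdiv ?(prime_gt1 pp) ?(prim_order_gt0 zetaP).
have pow := unity_root_pow pp w1p w1_neq1.
have Fw1 : ~ F w1 by move=> Fw1; apply: Fw0; have [i ->] := pow _ w01;
  exact: rangeX.
have [c Cc cw] : exists2 c, C c & conj_exp c w1 != w1.
  apply: contrapT => h; apply: Fw1; apply: conj_exp_fixed => // c Cc.
  by apply/eqP/negPn/negP => hc; apply: h; exists c.
have conj_w w d : C d -> w ^+ p = 1 -> conj_exp d w = w ^+ d.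
  move=> Cd /pow[i ->]; rewrite conj_expX //.
  by rewrite /w1 conj_exp_gen // exprAC.
have twist d : C d -> exists2 w, w ^+ p = 1 & conj_exp d y = w * y.
  move=> Cd; exists (conj_exp d y / y); last by rewrite mulfVK.
  by rewrite expr_div_n -conj_expX // conj_exp_range // divff // expf_neq0.
have Ecy := conj_exp_ext Cc Ey; have cy0 := conj_exp_neq0 Cc Ey y0.
have Fb : F (y ^+ c / conj_exp c y).
  apply: conj_exp_fixed => [|d Cd].
    by apply: simple_extM; [exact: simple_extX | exact: simple_extV].
  rewrite conj_expM ?conj_expV ?conj_expX //;
    [|exact: simple_extX|exact: simple_extV].
  have [w wp wy] := twist d Cd.
  have w_0 : w != 0 := unity_root_neq0 (prime_gt0 pp) wp.
  have Ew : E w by have [i ->] := pow _ wp; exact: simple_extX.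
  rewrite conj_exp_comm // wy conj_expM // conj_w // exprMn.
  by rewrite -mulf_div divff ?mul1r // expf_neq0.
have [w wp wy] := twist c Cc.
(* [c + p.-1] stands for [c - 1] modulo [p] and avoids truncated subtraction. If [p] divided it,
   [conj_exp c] would fix [w1]. *)
have cop : coprime (c + p.-1) p.
  rewrite coprime_sym prime_coprime //; apply: contra cw => /dvdnP[t te].
  have w1_0 : w1 != 0 := unity_root_neq0 (prime_gt0 pp) w1p.
  rewrite conj_w //; apply/eqP/(mulIf (expf_neq0 p.-1 w1_0)).
  by rewrite -exprD te mulnC -exprS prednK ?prime_gt0 // exprM w1p expr1n.
have yd : y ^+ (c + p.-1) = (y ^+ c / conj_exp c y) * y ^+ p * w.
  have w_0 : w != 0.
    exact: unity_root_neq0 (prime_gt0 pp) wp.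
  have -> : y ^+ p = y ^+ p.-1 * y by rewrite -exprSr prednK ?prime_gt0.
  by rewrite wy exprD; field; rewrite w_0 y0.
set g := _ * y ^+ p in yd.
have Fg : F g by exact: rangeM.
have d0 : (0 < c + p.-1)%N by have := prime_gt1 pp; lia.
(* With [u * (c + p.-1) = v * p + 1], raising [yd] to the power [u] expresses [y] as [w ^+ u] times
   an element of [K]. *)
case: (egcdnP p d0) => u v uv _; rewrite (eqP cop) in uv.
exists (w ^+ u); first by rewrite exprAC wp expr1n.
have -> : y / w ^+ u = g ^+ u / (y ^+ p) ^+ v.
  have w_0 : w != 0 := unity_root_neq0 (prime_gt0 pp) wp.
  apply/eqP; rewrite eqr_div ?expf_neq0 //; apply/eqP.
  by rewrite -exprM [(p * v)%N]mulnC -exprS -addn1 -uv -exprMn -yd mulnC exprM.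
by apply: range_div; exact: rangeX.
Qed.
End Cyclotomic.

(** * The groups R_N K^* *)

Lemma mul_subgroup_coprime (L : fieldType) (G : set L) (x : L) (b c : nat) :
  mul_subgroup G -> (0 < b)%N -> coprime b c -> G (x ^+ b) -> G (x ^+ c) ->
    x != 0 -> G x.
Proof.
move=> sgG b0 /eqP bc xb xc x0; case: (egcdnP c b0) => u v; rewrite bc => uv _.
have -> : x = x ^+ b ^+ u / x ^+ c ^+ v.
  by rewrite -!exprM [(b * u)%N]mulnC uv exprD expr1 [(c * v)%N]mulnC mulrAC
    divff ?mul1r // expf_neq0.
by apply: mul_subgroup_div => //; exact: mul_subgroupX.
Qed.

Section RadicalGroups.
Variables (K : fieldType) (L : closedFieldType) (iota : {rmorphism K -> L}).
Variable R : nat -> set L.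
Hypothesis R_subgroup : forall N : nat, (0 < N)%N -> mul_subgroup (R N).
Hypothesis R_one : R 1%N `<=` base_units iota.
Hypothesis R_power : forall N M : nat, (0 < N)%N -> (M %| N)%N ->
  power_set (R N) M = R (N %/ M)%N.

Definition radical_group N := mul_set (R N) (base_units iota).
Let G := radical_group.

Lemma base_units_subgroup : mul_subgroup (base_units iota).
Proof. exact: nonzero_range_subgroup. Qed.

Lemma radical_group_subgroup N : (0 < N)%N -> mul_subgroup (G N).
Proof. by move=> /R_subgroup sgR; apply: mul_set_subgroup base_units_subgroup. Qed.

Lemma base_units_sub_radical_group N : (0 < N)%N -> base_units iota `<=` G N.
Proof. by move=> /R_subgroup sgR; apply: mul_set_subr. Qed.

Lemma radical_pow N M x : (0 < N)%N -> (M %| N)%N -> R N x -> R (N %/ M)%N (x ^+ M).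
Proof. by move=> N0 MN Rx; rewrite -R_power //; exists x. Qed.

Lemma radical_expn N x : (0 < N)%N -> R N x -> range iota (x ^+ N).
Proof.
move=> N0 /(radical_pow N0 (dvdnn N)); rewrite divnn N0 => /R_one.
by case.
Qed.

(** [R_power] identifies [R M] with the [N %/ M]-th powers of [R N]. *)
Lemma radical_sub N M : (0 < N)%N -> (M %| N)%N -> R M `<=` R N.
Proof.
move=> N0 MN x; have M0 : (0 < M)%N := dvdn_gt0 N0 MN.
have -> : M = (N %/ (N %/ M))%N by rewrite divnA // mulKn.
rewrite -R_power // ?dvdn_div // => -[y Ry <-].
by apply: mul_subgroupX => //; exact: R_subgroup.
Qed.

Lemma radical_group_sub N M : (0 < N)%N -> (M %| N)%N -> G M `<=` G N.
Proof.
by move=> N0 MN _ [x /(radical_sub N0 MN) Rx [y Fy <-]]; exists x => //; exists y.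
Qed.

Lemma radical_group_pow N M x : (0 < N)%N -> (M %| N)%N -> G N x ->
  G (N %/ M)%N (x ^+ M).
Proof.
move=> N0 MN [r Rr [k Fk <-]]; exists (r ^+ M); first exact: radical_pow.
exists (k ^+ M); last by rewrite exprMn.
by apply: mul_subgroupX => //; exact: base_units_subgroup.
Qed.

Lemma radical_group_expn N x : (0 < N)%N -> G N x -> range iota (x ^+ N).
Proof.
move=> N0 [r Rr [k [Fk _] <-]]; rewrite exprMn; apply: rangeM;
  first exact: radical_expn.
exact: rangeX.
Qed.

(* With A, A' the parts of N, M at the primes p such that v_p(N) <= v_p(M), and
   B, B' the other parts: x ^ B lies in G_A, x ^ A' in G_B', and B, A' are
   coprime. *)
Lemma radical_group_gcd N M x : (0 < N)%N -> (0 < M)%N ->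
  G N x -> G M x -> G (gcdn N M) x.
Proof.
move=> N0 M0 GN GM; have g0 : (0 < gcdn N M)%N by rewrite gcdn_gt0 N0.
have sgG := radical_group_subgroup g0.
pose pi : nat_pred := [pred p | logn p N <= logn p M]%N.
have NE := partnC pi N0; have ME := partnC pi M0.
have part_dvd (rho : nat_pred) m n : (0 < m)%N -> (0 < n)%N ->
    (forall p, p \in rho -> (logn p m <= logn p n)%N) -> (m`_rho %| n)%N.
  move=> m0 n0 le; apply/dvdn_partP => [|p]; first exact: part_gt0.
  move=> p_in; have prho := pnatPpi (part_pnat rho m) p_in.
  have pp : prime p by move: p_in; rewrite mem_primes => /andP[].
  apply: dvdn_trans (partn_dvd p m0 (dvdn_part rho m)) _.
  by rewrite p_part pfactor_dvdn // le.
have Ag : (N`_pi %| gcdn N M)%N by rewrite dvdn_gcd dvdn_part part_dvd // => p;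
  rewrite inE.
have Bg : (M`_pi^' %| gcdn N M)%N.
  rewrite dvdn_gcd dvdn_part part_dvd // => p; rewrite !inE -ltnNge; exact: ltnW.
have x0 : x != 0 := mul_subgroup_neq0 (radical_group_subgroup N0) GN.
apply: (@mul_subgroup_coprime _ _ _ (N`_pi^')%N (M`_pi)%N) => //.
- by rewrite coprime_sym (@pnat_coprime pi) // part_pnat.
- apply: (radical_group_sub g0 Ag); rewrite -[X in G X](_ : (N %/ N`_pi^')%N = _).
    by apply: radical_group_pow => //; exact: dvdn_part.
  by rewrite -{1}NE mulnK // part_gt0.
- apply: (radical_group_sub g0 Bg); rewrite -[X in G X](_ : (M %/ M`_pi)%N = _).
    by apply: radical_group_pow => //; exact: dvdn_part.
  by rewrite -{1}ME mulKn // part_gt0.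
Qed.

End RadicalGroups.

(** * Transversals and indices *)

Section Transversals.
Variables (L : fieldType) (H A : set L).
Hypotheses (sgH : mul_subgroup H) (sgA : mul_subgroup A).

Definition transversal_seq (s : seq L) : Prop :=
  [/\ forall x, x \in s -> H x, pairwise (inequiv A) s &
      forall x, H x -> exists2 y, y \in s & A (x / y)].

Lemma subgroup_divC x y : A (x / y) -> A (y / x).
Proof. by move/(mul_subgroupV sgA); rewrite invf_div. Qed.

Lemma subgroup_div_trans y x z : H y -> A (x / y) -> A (y / z) -> A (x / z).
Proof.
move=> /(mul_subgroup_neq0 sgH) y0 h /(mul_subgroupM sgA h).
by rewrite mulrA mulfVK.
Qed.

Lemma transversal_of_cover (t : seq L) :
  (forall x, x \in t -> H x) -> (forall x, H x -> exists2 y, y \in t & A (x / y)) ->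
  exists s, transversal_seq s.
Proof.
move=> tH cov.
suff [s [sH ps st]] : exists s, [/\ forall x, x \in s ->
  H x, pairwise (inequiv A) s &
    forall x, x \in t -> exists2 y, y \in s & A (x / y)].
  exists s; split=> // x /cov[y yt xy]; have [z zs yz] := st y yt.
  by exists z => //; apply: subgroup_div_trans (tH y yt) xy yz.
elim: t tH {cov} => [|a t IHt] tH; first by exists [::].
have [x xt|s [sH ps st]] := IHt; first by apply: tH; rewrite inE xt orbT.
case: (pselect (exists2 y, y \in s & A (a / y))) => [ay|nay].
  by exists s; split=> // x; rewrite inE => /predU1P[->|/st].
exists (a :: s); split.
- by move=> x; rewrite inE => /predU1P[->|/sH//]; apply: tH; rewrite mem_head.
- rewrite /= ps andbT; apply/allP => y ys; apply/inequivP => Aay.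
  by apply: nay; exists y.
move=> x; rewrite inE => /predU1P[->|/st[y ys xy]].
  exists a; rewrite ?mem_head // divff; first exact: mul_subgroup1.
  by apply/(mul_subgroup_neq0 sgH)/tH; rewrite mem_head.
by exists y; rewrite // inE ys orbT.
Qed.

Lemma transversal_uniq s : transversal_seq s -> forall x y, x \in s -> y \in s ->
  A (x / y) -> x = y.
Proof.
case=> sH ps _ x y xs ys xy; apply: contrapT => /eqP nxy.
have lt i j : (i < j < size s)%N -> A (s`_i / s`_j) -> False.
  by move=> /andP[ij js]; apply/inequivP; move/(pairwiseP 0): ps; apply;
    rewrite ?inE // (ltn_trans ij).
have ix : (index x s < size s)%N by rewrite index_mem.
have iy : (index y s < size s)%N by rewrite index_mem.
have [xi yi] := (nth_index 0 xs, nth_index 0 ys).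
case: (ltngtP (index x s) (index y s)) => [h|h|h].
- by apply: (lt (index x s) (index y s)); rewrite ?h ?xi ?yi.
- by apply: (lt (index y s) (index x s)); rewrite ?h ?xi ?yi //;
  exact: subgroup_divC.
- by move: nxy; rewrite -xi h yi eqxx.
Qed.

Lemma transversal_seq_uniq s : transversal_seq s -> uniq s.
Proof.
move=> [sH ps _]; rewrite uniq_pairwise;
  apply: (sub_in_pairwise (P := mem s)) ps; last exact/allP.
move=> x y xs _ /inequivP nxy /=; apply: contra_notN nxy => /eqP <-.
by rewrite divff ?(mul_subgroup_neq0 sgH (sH x xs)) //; exact: mul_subgroup1.
Qed.

Lemma pairwise_inequiv s : uniq s ->
  (forall x y, x \in s -> y \in s -> A (x / y) -> x = y) -> pairwise (inequiv A) s.
Proof.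
rewrite uniq_pairwise => us h.
apply: (sub_in_pairwise (P := mem s)) us; last exact/allP.
by move=> x y xs ys /eqP nxy; apply/inequivP => /h e; apply: nxy; apply: e.
Qed.

Lemma coset_eqP x y : H x -> H y ->
  [set x * z | z in A] = [set y * z | z in A] <-> A (x / y).
Proof.
move=> Hx Hy; have x0 := mul_subgroup_neq0 sgH Hx;
  have y0 := mul_subgroup_neq0 sgH Hy.
split=> [e|Axy].
  have : [set x * z | z in A] x by exists 1; rewrite ?mulr1 //;
    exact: mul_subgroup1.
  by rewrite e => -[z Az <-]; rewrite mulrC mulKf.
apply/seteqP; split=> _ [z Az <-].
  exists (x / y * z); first exact: mul_subgroupM.
  by rewrite mulrA mulrCA mulfV ?mulr1.
exists (y / x * z); first by apply: mul_subgroupM => //; exact: subgroup_divC.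
by rewrite mulrA mulrCA mulfV ?mulr1.
Qed.

Lemma group_index_transversal s : transversal_seq s -> group_index H A = size s.
Proof.
move=> ts; have [sH ps cov] := ts.
pose cs x := [set x * z | z in A].
have us : uniq s.
  exact: transversal_seq_uniq.
rewrite /group_index.
have -> : cosets H A = [set` seq_fset tt (map cs s)].
  apply/seteqP; split=> B.
    suff h : cosets H A B -> B \in map cs s by move=> /h Bs;
      by rewrite -(seq_fsetE tt) in Bs.
    move=> [x /[dup] Hx /cov[y ys xy] <-]; apply/mapP; exists y => //.
    by apply/coset_eqP => //; exact: sH.
  have : B \in map cs s -> cosets H A B.
    by move=> /mapP[x xs ->]; exists x => //; exact: sH.
  move=> h Bs; apply: h; by rewrite -(seq_fsetE tt).
rewrite set_fsetK size_seq_fset undup_id ?size_map // map_inj_in_uniq //.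
move=> x y xs ys /coset_eqP h; apply: (transversal_uniq ts) => //.
by apply: h; exact: sH.
Qed.

(** [fset_set] of an infinite set is empty, so a positive index forces finitely many cosets, from
    each of which a representative is chosen. *)
Lemma cover_of_group_index : (0 < group_index H A)%N ->
  exists t : seq L, (forall x, x \in t -> H x) /\
    (forall x, H x -> exists2 y, y \in t & A (x / y)).
Proof.
move=> i0; have fin : finite_set (cosets H A).
  apply: contrapT => nf; move: i0.
  by rewrite /group_index /fset_set; case: pselect => // ? ; rewrite cardfs0.
have /finite_seqP[B BE] := fin.
have rep C : exists x, C \in B -> H x /\ [set x * z | z in A] = C.
  case: (boolP (C \in B)) => [CB|]; last by exists 0.
  by have : [set` B] C := CB; rewrite -BE => -[x Hx <-]; exists x.
have [r rP] := choice rep.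
exists [seq r C | C <- B]; split=> [x /mapP[C CB ->]|x Hx].
  by have [] := rP C CB.
have : [set` B] [set x * z | z in A] by rewrite -BE; exists x.
move=> /= CB; exists (r [set x * z | z in A]); first exact: map_f.
have [Hr rE] := rP _ CB.
by apply/coset_eqP.
Qed.

End Transversals.

Lemma transversal_mul (L : fieldType) (H B A : set L) (s t : seq L) :
  mul_subgroup H -> mul_subgroup B -> mul_subgroup A -> A `<=` B -> B `<=` H ->
  transversal_seq H B s -> transversal_seq B A t ->
  transversal_seq H A [seq x * y | x <- s, y <- t].
Proof.
move=> sgH sgB sgA AB BH ts tt; have [sH _ scov] := ts; have [tB _ tcov] := tt.
have xyH x y : x \in s -> y \in t -> H (x * y).
  by move=> /sH Hx /tB/BH Hy; exact: mul_subgroupM.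
split.
- by move=> _ /allpairsP[[x y] [/= xs yt ->]]; exact: xyH.
- have inj x y x' y' : x \in s -> y \in t -> x' \in s -> y' \in t ->
      A (x * y / (x' * y')) -> x = x' /\ y = y'.
    move=> xs yt xs' yt' Axy.
    have y0 := mul_subgroup_neq0 sgB (tB y yt).
    have y'0 := mul_subgroup_neq0 sgB (tB y' yt').
    have x'0 := mul_subgroup_neq0 sgH (sH x' xs').
    have ex : x = x'.
      apply: (transversal_uniq sgB ts xs xs').
      rewrite (_ : x / x' = x * y / (x' * y') * (y' / y)); last by field;
        rewrite y0 y'0.
      apply: mul_subgroupM => //; first exact: AB.
      by apply: mul_subgroup_div => //; exact: tB.
    split=> //; apply: (transversal_uniq sgA tt yt yt').
    by move: Axy; rewrite ex -mulf_div divff ?mul1r.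
  apply: pairwise_inequiv.
    apply: allpairs_uniq (transversal_seq_uniq sgH sgB ts) (transversal_seq_uniq
      sgB sgA tt) _.
    move=> [x y] [x' y'] /allpairsP[[a b] [/= xs yt [-> ->]]].
    move=> /allpairsP[[a' b'] [/= xs' yt' [-> ->]]] e.
    have [|-> -> //] := inj a b a' b' xs yt xs' yt'.
    rewrite e divff; first exact: mul_subgroup1.
    by apply/(mul_subgroup_neq0 sgH)/xyH.
  move=> _ _ /allpairsP[[a b] [/= xs yt ->]] /allpairsP[[a' b'] [/= xs' yt' ->]].
  by case/inj => // -> ->.
move=> h Hh; have [x xs hx] := scov h Hh; have [y yt hy] := tcov _ hx.
exists (x * y); first exact: allpairs_f.
by rewrite invfM mulrA.
Qed.

(** * Bases and degrees *)

Section Bases.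
Variables (K : fieldType) (L : closedFieldType) (iota : {rmorphism K -> L}).
Implicit Types (F : set L).

Definition lin_comb (I : finType) (e : I -> L) (a : {ffun I -> K}) : L :=
  \sum_i iota (a i) * e i.

Definition spanning F (I : finType) (e : I -> L) : Prop :=
  (forall i, F (e i)) /\ forall x, F x -> exists a, x = lin_comb e a.

Lemma lin_combD (I : finType) (e : I -> L) (a b : {ffun I -> K}) c :
  lin_comb e [ffun i => a i + c * b i] = lin_comb e a + iota c * lin_comb e b.
Proof.
rewrite /lin_comb mulr_sumr -big_split /=; apply: eq_bigr => i _.
by rewrite ffunE rmorphD rmorphM mulrDl mulrA.
Qed.

Lemma has_basis_finType F (I : finType) (e : I -> L) : spanning F e ->
  (forall a, lin_comb e a = 0 -> a = [ffun=> 0]) -> has_basis iota F #|I|.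
Proof.
move=> [Fe span] free; exists (fun j => e (enum_val j)); split=> // x /span[a ->].
have reindex (b : {ffun 'I_#|I| -> K}) :
    \sum_(j < #|I|) iota (b j) * e (enum_val j) =
    lin_comb e [ffun i => b (enum_rank i)].
  rewrite /lin_comb (reindex (@enum_val I xpredT)) /=; last first.
    by exists enum_rank => i _; rewrite ?enum_rankK ?enum_valK.
  by apply: eq_bigr => j _; rewrite ffunE enum_valK.
exists [ffun j => a (enum_val j)]; split.
  by rewrite reindex; apply: eq_bigr => i _; rewrite !ffunE enum_rankK.
move=> b; rewrite reindex => e_ab; apply/ffunP => j; rewrite ffunE.
set b' := [ffun i => b (enum_rank i)] in e_ab.
have : lin_comb e [ffun i => a i + (-1) * b' i] = 0.
  by rewrite lin_combD rmorphN1 mulN1r e_ab subrr.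
move/free/ffunP/(_ (enum_val j)); rewrite !ffunE enum_valK mulN1r.
by move/eqP; rewrite subr_eq0 => /eqP.
Qed.

Lemma has_basis_leq F n m : has_basis iota F n -> has_basis iota F m -> (n <= m)%N.
Proof.
move=> [e [Fe be]] [f [Ff bf]]; rewrite leqNgt; apply/negP => mn.
have coef i : exists a : {ffun 'I_m -> K}, e i = \sum_(j < m) iota (a j) * f j.
  by have [a [-> _]] := bf _ (Fe i); exists a.
have [A AE] := choice coef; pose M := \matrix_(i, j) A i j.
have : kermx M != 0.
  rewrite kermx_eq0 /row_free neq_ltn; apply/orP; left.
  exact: leq_ltn_trans (rank_leq_col M) mn.
case/rowV0Pn => u /sub_kermxP uM u0.
have [i ui] : exists i, u 0 i != 0.
  by apply/existsP; apply: contraNT u0 => /existsPn h; apply/eqP/rowP => i;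
    rewrite mxE; apply/eqP/negPn/h.
have u_dep : \sum_i iota (u 0 i) * e i = 0.
  under eq_bigr do rewrite AE mulr_sumr.
  rewrite exchange_big /= big1 // => j _.
  under eq_bigr do rewrite mulrA -rmorphM.
  rewrite -mulr_suml -rmorph_sum /=.
  have := congr1 (fun B : 'rV_m => B 0 j) uM; rewrite !mxE => h.
  have -> : \sum_i u 0 i * A i j = 0.
    by rewrite -[RHS]h; apply: eq_bigr => k _; rewrite mxE.
  by rewrite rmorph0 mul0r.
have [a [ea ua]] := be _ (Fe i).
suff : a = [ffun k => a k + u 0 k].
  move/ffunP/(_ i)/eqP; rewrite ffunE -{1}[a i]addr0 (inj_eq (addrI _)) eq_sym.
  by rewrite (negPf ui).
apply: ua; transitivity (e i + \sum_k iota (u 0 k) * e k).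
  by rewrite u_dep addr0.
rewrite {1}ea -big_split /=.
by apply: eq_bigr => k _; rewrite ffunE rmorphD mulrDl.
Qed.

Lemma degree_has_basis F n : has_basis iota F n -> degree iota F = n.
Proof.
move=> bn; apply: xget_unique => // m bm.
by apply/eqP; rewrite eqn_leq !(has_basis_leq (F := F)).
Qed.

Lemma free_spanning F (I : finType) (e : I -> L) : spanning F e ->
  exists n (f : 'I_n -> L), spanning F f /\
    forall a, lin_comb f a = 0 -> a = [ffun=> 0].
Proof.
move=> sp; pose T n := `[< exists f : 'I_n -> L, spanning F f >].
have exT : exists n, T n.
  exists #|I|; apply/asboolP; exists (fun j => e (enum_val j)).
  case: sp => Fe span; split=> // x /span[a ->]; exists [ffun j => a (enum_val j)].
  rewrite /lin_comb (reindex (@enum_val I xpredT)) /=; last first.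
    by exists enum_rank => i _; rewrite ?enum_rankK ?enum_valK.
  by apply: eq_bigr => j _; rewrite ffunE.
case: (ex_minnP exT) => n /asboolP[f [Ff spf]] min; exists n, f; split=> // a a0.
apply: contrapT => na.
have [i ai] : exists i, a i != 0.
  apply/existsP; apply: contra_notT na => /existsPn h; apply/ffunP => i.
  by rewrite ffunE; apply/eqP/negPn/h.
case: n => [|n] in f Ff spf min a a0 na i ai *; first by case: i ai.
suff /min : T n by rewrite ltnn.
apply/asboolP; exists (fun j => f (lift i j)); split=> // x /spf[b ->].
exists [ffun j => b (lift i j) - b i / a i * a (lift i j)].
have : lin_comb f b = lin_comb f [ffun j => b j + (- (b i / a i)) * a j].
  by rewrite lin_combD a0 mulr0 addr0.
move=> ->; rewrite /lin_comb (bigD1_ord i) //= ffunE mulNr mulfVK // subrr.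
by rewrite rmorph0 mul0r add0r; apply: eq_bigr => j _; rewrite !ffunE mulNr.
Qed.

End Bases.

Section Adjoin.
Variables (K : fieldType) (L : closedFieldType) (iota : {rmorphism K -> L}).
Hypothesis L_algebraic : integralRange iota.

Lemma integral_annihilator x : exists2 p : {poly K}, p != 0 & root (map_poly iota
  p) x.
Proof. by have [p mp px] := L_algebraic x; exists p => //; exact: monic_neq0. Qed.

Lemma integral_inverse x : exists P : {poly K}, x^-1 = (map_poly iota P).[x].
Proof.
have [p p0 px] := integral_annihilator x.
have : range (subfx_inj : subFExtend iota x p -> L) x^-1.
  apply: rangeV; rewrite range_subfx_inj //.
  by exists 'X; rewrite // map_polyX hornerX.
by rewrite range_subfx_inj // => -[P _ <-]; exists P.
Qed.

Definition sum_set (H : set L) : set L :=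
  [set x | exists2 s : seq L, (forall y, y \in s -> H y) & x = \sum_(y <- s) y].

Section SumSet.
Variable H : set L.
Hypotheses (sgH : mul_subgroup H) (FH : base_units iota `<=` H).

Lemma sum_set_mem x : H x -> sum_set H x.
Proof.
by move=> Hx; exists [:: x]; rewrite ?big_seq1 // => y; rewrite inE => /eqP ->.
Qed.

Lemma sum_set0 : sum_set H 0.
Proof. by exists [::]; rewrite ?big_nil. Qed.

Lemma sum_setD x y : sum_set H x -> sum_set H y -> sum_set H (x + y).
Proof.
move=> [s sH ->] [t tH ->]; exists (s ++ t); rewrite ?big_cat //.
by move=> z; rewrite mem_cat => /orP[/sH|/tH].
Qed.

Lemma sum_setM x y : sum_set H x -> sum_set H y -> sum_set H (x * y).
Proof.
move=> [s sH ->] [t tH ->]; exists [seq u * v | u <- s, v <- t].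
  by move=> _ /allpairsP[[u v] [/= /sH Hu /tH Hv ->]]; exact: mul_subgroupM.
by rewrite big_allpairs_dep mulr_suml; apply: eq_bigr => u _; rewrite mulr_sumr.
Qed.

Lemma sum_set_range x : range iota x -> sum_set H x.
Proof.
move=> Fx; have [->|x0] := eqVneq x 0; first exact: sum_set0.
by apply/sum_set_mem/FH/nonzero_rangeP.
Qed.

Lemma sum_set_horner (P : {poly K}) x : sum_set H x ->
  sum_set H (map_poly iota P).[x].
Proof.
move=> Hx; elim/poly_ind: P => [|P c IHP].
  by rewrite rmorph0 horner0; exact: sum_set0.
rewrite rmorphD rmorphM /= map_polyX map_polyC !hornerE.
by apply: sum_setD; [exact: sum_setM | apply: sum_set_range; exists c].
Qed.

(** Division causes no trouble because the inverse of an algebraic element is a polynomial in it.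
    This is why [K(R)] consists of the finite sums of elements of [R K^*]. *)
Lemma sum_set_subfield : is_subfield (sum_set H).
Proof.
have sum_setN x : sum_set H x -> sum_set H (- x).
  by rewrite -mulN1r; apply: sum_setM; apply: sum_set_range; exists (-1);
    rewrite ?rmorphN1.
split=> [|x y /set_mem Hx /set_mem Hy|x y /set_mem Hx /set_mem Hy]; apply/mem_set.
- by apply: sum_set_range; exact: range1.
- by apply: sum_setD => //; exact: sum_setN.
- apply: sum_setM => //; have [P ->] := integral_inverse y.
  exact: sum_set_horner.
Qed.
End SumSet.

Lemma subfieldP (M : set L) : is_subfield M ->
  [/\ M 0, forall x y, M x -> M y -> M (x + y) &
      forall x y, M x -> M y -> M (x * y)].
Proof.
case=> /set_mem M1 MB MV.
have {}MB x y : M x -> M y -> M (x - y).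
  by move=> /mem_set Mx /mem_set My; apply/set_mem; exact: MB.
have {}MV x y : M x -> M y -> M (x / y).
  by move=> /mem_set Mx /mem_set My; apply/set_mem; exact: MV.
have M0 : M 0 by rewrite -(subrr 1); exact: MB.
split=> // x y Mx My.
  by rewrite -[y]opprK -[- y]sub0r; do 2!apply: (MB) => //.
by rewrite -[y]invrK -[y^-1]div1r; do 2!apply: (MV) => //.
Qed.

Lemma adjoin_sum_set (R : set L) : mul_subgroup R ->
  adjoin iota R = sum_set (mul_set R (base_units iota)).
Proof.
move=> sgR; have sgF := base_units_subgroup iota.
apply/seteqP; split=> x.
  apply: smallest_sub; first exact: sum_set_subfield (mul_set_subgroup sgR sgF)
    (mul_set_subr sgR).
  move=> y [Fy|Ry]; first exact: sum_set_range (mul_set_subr sgR) _ Fy.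
  by apply: sum_set_mem; exact: mul_set_subl.
move=> [s sH ->] M [/subfieldP[M0 MD MM] sM].
rewrite big_seq; apply: big_ind => // y /sH[r Rr [k [Fk _] <-]].
by apply: MM; apply: sM; [right | left].
Qed.

Lemma adjoin_simple (x : L) : adjoin iota [set x] = simple_ext iota x.
Proof.
have [p p0 px] := integral_annihilator x.
have E := range_subfx_inj p0 px.
have E' : simple_ext iota x = range (subfx_inj : subFExtend iota x p ->
  L) by rewrite E.
apply/seteqP; split=> y.
  apply: smallest_sub.
    rewrite E'; split=> [|u v /set_mem Fu /set_mem Fv|u v /set_mem Fu /set_mem
      Fv]; apply/mem_set.
    - exact: range1.
    - by apply: rangeD => //; exact: rangeN.
    - exact: range_div.
  move=> z [[k _ <-]|->]; last by exists 'X; rewrite // map_polyX hornerX.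
  by exists k%:P; rewrite // map_polyC hornerC.
move=> [P _ <-] M [/subfieldP[M0 MD MM] sM].
elim/poly_ind: P => [|P c IHP]; first by rewrite rmorph0 horner0.
rewrite rmorphD rmorphM /= map_polyX map_polyC !hornerE.
by apply: MD; [apply: MM => //; apply: sM; right | apply: sM; left; exists c].
Qed.

End Adjoin.

(** Turns [sum_free] into linear independence: a nonzero coefficient is absorbed into the element of
    [H] without changing its class, and the zero terms are filtered out. *)
Lemma sum_free_coef (K L : fieldType) (iota : {rmorphism K -> L}) (H : set L)
    (I : eqType) (l : seq I) (f e : I -> L) :
  mul_subgroup H -> nonzero (range iota) `<=` H -> sum_free (range iota) H ->
  (forall i, i \in l -> H (f i)) -> pairwise (inequiv (range iota)) (map f l) ->
  (forall i, i \in l -> range iota (e i)) ->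
  \sum_(i <- l) e i * f i = 0 -> forall i, i \in l -> e i = 0.
Proof.
move=> sgH FH sfH Hf pf Fe e0.
suff : [seq e i * f i | i <- l & e i != 0] = [::].
  move=> h i il; apply/eqP/negPn/negP => ei.
  have : e i * f i \in [seq e i * f i | i <- l & e i != 0].
    by apply/mapP; exists i => //; rewrite mem_filter ei.
  by rewrite h.
apply: sfH.
- move=> x /mapP[i]; rewrite mem_filter => /andP[ei il] ->.
  apply: mul_subgroupM => //; last exact: Hf.
  by apply: FH; apply/nonzero_rangeP; split=> //; exact: Fe.
- move: pf; rewrite !pairwise_map => /(pairwise_filter (fun i => e i != 0)).
  apply: (sub_in_pairwise (P := [pred i | (i \in l) && (e i != 0)])); last first.
    by apply/allP => i; rewrite mem_filter inE andbC.
  move=> i j /andP[il ei] /andP[jl ej] /inequivP nij /=; apply/inequivP => h;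
    apply: nij.
  have fj : f j != 0 by apply: mul_subgroup_neq0 (Hf _ jl).
  have -> : f i / f j = (e i * f i / (e j * f j)) * (e j / e i) by field;
    rewrite ei ej fj.
  by apply: rangeM => //; apply: range_div; apply: Fe.
- rewrite big_map big_filter -[RHS]e0 [RHS](bigID (fun i => e i != 0)) /=.
  by rewrite [X in _ = _ + X]big1 ?addr0 // => i /negPn/eqP ->; rewrite mul0r.
Qed.

Section Ratio.
Variables (K : fieldType) (L : closedFieldType) (iota : {rmorphism K -> L}).
Hypothesis L_algebraic : integralRange iota.
Variables (K2 : fieldType) (iota2 : {rmorphism K2 -> L}).
Let F := range iota.
Let E := range iota2.
Hypothesis FE : F `<=` E.
Let Kx := base_units iota.
Let Ex := nonzero E.
Variables (R R' : set L).
Hypotheses (sgR : mul_subgroup R) (sgR' : mul_subgroup R') (R'R : R' `<=` R).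
Let G := mul_set R Kx.
Let G' := mul_set R' Kx.
Hypothesis GE : forall x, G x -> E x -> G' x.
Hypothesis sfE : sum_free E (mul_set R Ex).

Let sgK : mul_subgroup Kx. Proof. exact: base_units_subgroup. Qed.
Let sgE : mul_subgroup Ex. Proof. exact: nonzero_range_subgroup. Qed.
Let sgG : mul_subgroup G. Proof. exact: mul_set_subgroup. Qed.
Let sgG' : mul_subgroup G'. Proof. exact: mul_set_subgroup. Qed.
Let KG : Kx `<=` G. Proof. exact: mul_set_subr. Qed.
Let KG' : Kx `<=` G'. Proof. exact: mul_set_subr. Qed.
Let G'G : G' `<=` G.
Proof. by move=> _ [r /R'R Rr [k Fk <-]]; exists r => //; exists k. Qed.
Let KE : Kx `<=` Ex. Proof. by move=> x [/FE Fx nx]; split. Qed.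

Let H := mul_set R Ex.
Let H' := mul_set R' Ex.
Let sgH : mul_subgroup H. Proof. exact: mul_set_subgroup. Qed.
Let sgH' : mul_subgroup H'. Proof. exact: mul_set_subgroup. Qed.
Let GH : G `<=` H.
Proof. by move=> _ [r Rr [k /KE Fk <-]]; exists r => //; exists k. Qed.
Let GH' : G' `<=` H'.
Proof. by move=> _ [r Rr [k /KE Fk <-]]; exists r => //; exists k. Qed.
Let H'H : H' `<=` H.
Proof. by move=> _ [r /R'R Rr [k Fk <-]]; exists r => //; exists k. Qed.
Let EH : Ex `<=` H. Proof. exact: mul_set_subr. Qed.
Let EH' : Ex `<=` H'. Proof. exact: mul_set_subr. Qed.

(** If [x = r * e] with [r] in [R'] and [e] in [E], then [e = x / r] lies in both [G] and [E], hence
    in [G'] by [GE]. Elements of [G] inequivalent modulo [G'] thus stay inequivalent modulo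
    [R' E^*]. *)
Let GH'_sub x : G x -> H' x -> G' x.
Proof.
move=> Gx [r Rr [e [Ee /eqP e0] re]].
have r0 := mul_subgroup_neq0 sgR' Rr.
have G'r : G' r by exact: mul_set_subl.
rewrite -re; apply: mul_subgroupM => //; apply: GE => //.
rewrite -(mulKf r0 e) re mulrC; apply: mul_subgroup_div => //; exact: G'G.
Qed.

Variables (s t : seq L).
Hypotheses (tr_s : transversal_seq G G' s) (tr_t : transversal_seq G' Kx t).

Lemma transversal_lift : transversal_seq H H' s.
Proof.
have [sG ps cov] := tr_s; split.
- by move=> x /sG; exact: GH.
- apply: (sub_in_pairwise (P := mem s)) ps; last exact/allP.
  move=> x y /sG Gx /sG Gy /inequivP nxy; apply/inequivP => h; apply: nxy.
  by apply: GH'_sub => //; exact: mul_subgroup_div.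
move=> _ [r Rr [e Ee <-]]; have Gr : G r by exact: mul_set_subl.
have [y ys ry] := cov r Gr; exists y => //; rewrite mulrAC.
by apply: mul_subgroupM => //; [exact: GH' | exact: EH'].
Qed.

(** Classes distinct modulo [K^*] may coincide modulo [E^*], so [t] is only a cover here and has to
    be thinned out. *)
Lemma transversal_base : exists T, transversal_seq H' Ex T.
Proof.
have [tG _ cov] := tr_t; apply: (@transversal_of_cover _ _ _ _ _ t) => //.
  by move=> x /tG; exact: GH'.
move=> _ [r Rr [e Ee <-]]; have Gr : G' r by exact: mul_set_subl.
have [y ys ry] := cov r Gr; exists y => //; rewrite mulrAC.
by apply: mul_subgroupM => //; exact: KE.
Qed.

Lemma sum_set_coef T x : transversal_seq H' Ex T -> sum_set G' x ->
  exists e : L -> L, (forall y, E (e y)) /\ x = \sum_(y <- T) e y * y.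
Proof.
move=> tT [u uG ->]; have [TH pT cov] := tT;
  have uT := transversal_seq_uniq sgH' sgE tT.
elim: u uG => [|a u IHu] uG.
  exists (fun=> 0); split=> [y|]; first exact: range0.
  by rewrite big_nil big1 // => y _; rewrite mul0r.
have [y yu|e [Ee eE]] := IHu; first by apply: uG; rewrite inE yu orbT.
have Ga : G' a by apply: uG; rewrite mem_head.
have [b bT [Eab _]] := cov a (GH' Ga).
have b0 := mul_subgroup_neq0 sgH' (TH b bT).
exists (fun y => e y + (if y == b then a / b else 0)); split=> [y|].
  by apply: rangeD; [exact: Ee | case: (y == b) => //; exact: range0].
rewrite big_cons eE addrC; under [RHS]eq_bigr do rewrite mulrDl.
rewrite big_split /=; congr (_ + _).
rewrite (bigD1_seq b) //= eqxx mulfVK // big1 ?addr0 // => y /negPf ->.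
by rewrite mul0r.
Qed.

(** Each [c x] expands over [E] along a transversal [T] of [R' E^*] modulo [E^*]. The products of
    [s] and [T] form a transversal of [R E^*] modulo [E^*], independent over [E] by [sfE], so every
    coefficient of these expansions vanishes. *)
Lemma relative_free (c : L -> L) : (forall x, x \in s -> sum_set G' (c x)) ->
  \sum_(x <- s) c x * x = 0 -> forall x, x \in s -> c x = 0.
Proof.
move=> cG c0; have [T tT] := transversal_base; have ts := transversal_lift.
have /choice[e eP] : forall x, exists e : L -> L, x \in s ->
    (forall y, E (e y)) /\ c x = \sum_(y <- T) e y * y.
  move=> x; case: (boolP (x \in s)) => xs; last by exists (fun=> 0).
  by have [e he] := sum_set_coef tT (cG x xs); exists e.
have tsT := transversal_mul sgH sgH' sgE EH' H'H ts tT.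
have [stH pst _] := tsT.
pose l := [seq (x, y) | x <- s, y <- T].
have ml : [seq u.1 * u.2 | u <- l] = [seq x * y | x <- s, y <- T].
  by rewrite /l map_allpairs.
have lP u : u \in l -> u.1 \in s /\ u.2 \in T.
  by move=> /allpairsP[[x y] [/= xs yT ->]].
have := @sum_free_coef _ _ iota2 H _ l (fun u => u.1 * u.2) (fun u => e u.1 u.2)
  sgH EH sfE.
rewrite ml => h x xs; have [_ ->] := eP x xs.
rewrite big_seq big1 // => y yT; rewrite (h _ _ _ _ (x, y)) ?mul0r //.
- by move=> u /lP[us uT]; apply: stH; exact: allpairs_f.
- apply: (sub_in_pairwise (P := mem [seq x * y | x <- s, y <- T])) pst;
  last exact/allP.
  move=> u v /stH Hu /stH Hv /inequivP nuv; apply/inequivP => Euv; apply: nuv.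
  apply/nonzero_rangeP; split=> //.
  by rewrite mulf_neq0 ?invr_eq0 ?(mul_subgroup_neq0 sgH).
- by move=> u /lP[us _]; exact: (eP _ us).1.
- rewrite big_allpairs_dep -[RHS]c0 [LHS]big_seq [RHS]big_seq;
  apply: eq_bigr => u us.
  have [_ ->] := eP u us; rewrite mulr_suml; apply: eq_bigr => v _ /=.
  by rewrite mulrAC -mulrA.
- exact: allpairs_f.
Qed.

Lemma spanning_transversal :
  spanning iota (sum_set G') (fun i : 'I_(size t) => t`_i).
Proof.
have [tG pt cov] := tr_t; split=> [i|_ [u uG ->]].
  by apply/sum_set_mem/tG/mem_nth.
elim: u uG => [|a u IHu] uG.
  exists [ffun=> 0]; rewrite big_nil /lin_comb big1 // => i _.
  by rewrite ffunE rmorph0 mul0r.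
have [y yu|b bE] := IHu; first by apply: uG; rewrite inE yu orbT.
have [y yt [[k _ ky] _]] := cov a (uG a (mem_head _ _)).
have iy : (index y t < size t)%N by rewrite index_mem.
exists [ffun i => b i + k * [ffun i => (i == Ordinal iy)%:R] i].
rewrite lin_combD big_cons bE addrC; congr (_ + _).
rewrite /lin_comb (bigD1 (Ordinal iy)) //= ffunE eqxx rmorph1 mul1r nth_index //.
rewrite big1 => [|i /negPf ni]; last by rewrite ffunE ni rmorph0 mul0r.
rewrite addr0 ky mulfVK //.
exact: mul_subgroup_neq0 (tG _ yt).
Qed.

Lemma kummer_ratio_eq : kummer_ratio iota R = kummer_ratio iota R'.
Proof.
(* [t] spans [K(R')] over [K] but may be dependent, so a basis [f] of some size [n] is taken. From
   [R'] to [R], both the degree [n] and the index [size t] get multiplied by [size s]. *)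
have [n [f [[Ff spf] frf]]] := free_spanning spanning_transversal.
have us := transversal_seq_uniq sgG sgG' tr_s.
have [sG _ scov] := tr_s.
have bV' : has_basis iota (sum_set G') n.
  by have := has_basis_finType (conj Ff spf) frf; rewrite card_ord.
have bV : has_basis iota (sum_set G) (n * size s).
  pose e (u : 'I_n * 'I_(size s)) := f u.1 * s`_u.2.
  have e_comb (a : {ffun 'I_n * 'I_(size s) -> K}) : lin_comb iota e a =
      \sum_(j < size s) lin_comb iota f [ffun i => a (i, j)] * s`_j.
    rewrite /lin_comb; under [RHS]eq_bigr do rewrite mulr_suml.
    rewrite exchange_big pair_bigA /=; apply: eq_bigr => -[i j] _.
    by rewrite ffunE /e /= mulrA.
  have {1}-> : (n * size s = #|{: 'I_n * 'I_(size s)}|)%N by rewrite card_prod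
    !card_ord.
  apply: (has_basis_finType (e := e)).
    split=> [[i j]|_ [u uG ->]].
      apply: sum_setM => //; last by apply/sum_set_mem/sG/mem_nth.
      by have [v vG ->] := Ff i; exists v => // y /vG; exact: G'G.
    elim: u uG => [|x u IHu] uG.
      exists [ffun=> 0]; rewrite big_nil /lin_comb big1 // => i _.
      by rewrite ffunE rmorph0 mul0r.
    have [y yu|b bE] := IHu; first by apply: uG; rewrite inE yu orbT.
    have [y ys Gxy] := scov x (uG x (mem_head _ _)).
    have [a aE] := spf _ (sum_set_mem Gxy).
    have iy : (index y s < size s)%N by rewrite index_mem.
    exists [ffun i => b i + 1 * [ffun i => if i.2 == Ordinal iy then a i.1 else
      0] i].
    rewrite lin_combD big_cons bE addrC rmorph1 mul1r; congr (_ + _).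
    rewrite e_comb (bigD1 (Ordinal iy)) //= big1 => [|j /negPf nj].
      rewrite addr0 nth_index // -[LHS](mulfVK (mul_subgroup_neq0 sgG (sG _ ys)))
        aE.
      congr (_ * _); apply: eq_bigr => i _; by rewrite !ffunE eqxx.
    rewrite /lin_comb big1 ?mul0r // => i _; by rewrite !ffunE nj rmorph0 mul0r.
  move=> a; rewrite e_comb => a0.
  (* [relative_free] wants coefficients indexed by the elements of [s] and not by their positions;
     since [s] has no repetition, the sum has one term for each [x] in [s]. *)
  pose c x := \sum_(j < size s | s`_j == x) lin_comb iota f [ffun i => a (i, j)].
  have cE (j : 'I_(size s)) : c s`_j = lin_comb iota f [ffun i => a (i, j)].
    by rewrite /c (big_pred1 j) // => k; rewrite nth_uniq.
  have cs x : x \in s -> sum_set G' (c x).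
    move=> _; rewrite /c; apply: big_ind => [||j _];
      [exact: sum_set0 | exact: sum_setD |].
    apply: big_ind => [||i _]; [exact: sum_set0 | exact: sum_setD |].
    apply: (sum_setM sgG' _ (Ff i)); apply: (sum_set_range KG').
    by exists ([ffun i => a (i, j)] i).
  apply/ffunP => -[i j]; rewrite ffunE.
  have : c s`_j = 0.
    apply: (relative_free cs); last exact: mem_nth.
    rewrite (big_nth 0) big_mkord -[RHS]a0.
    by apply: eq_bigr => k _; rewrite cE.
  by rewrite cE => /frf/ffunP/(_ i); rewrite !ffunE.
have tr_st := transversal_mul sgG sgG' sgK KG' G'G tr_s tr_t.
rewrite /kummer_ratio !(adjoin_sum_set L_algebraic) // (degree_has_basis bV).
rewrite (degree_has_basis bV') (group_index_transversal sgG sgK tr_st).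
rewrite (group_index_transversal sgG' sgK tr_t) size_allpairs !natrM.
have s0 : (size s)%:R != 0 :> rat.
  rewrite Num.Theory.pnatr_eq0 size_eq0;
    have [y ys _] := scov 1 (mul_subgroup1 sgG).
  by apply: contraTneq ys => ->.
by rewrite [X in _ / X]mulrC invfM mulrA mulrAC mulfK // mulrAC.
Qed.

End Ratio.

(** * Torsion modulo K^* and roots of unity *)

(** An exponent that kills a coset representative sends the whole coset into [G]; [w] is the product
    of such exponents over the finitely many cosets. *)
Lemma torsion_index_exponent (L : fieldType) (H G : set L) :
  finite_set (cosets (mu_infty H) (mu_infty G)) -> mul_subgroup G ->
  exists2 w, (0 < w)%N & forall y, mu_infty H y -> G (y ^+ w).
Proof.
move=> /finite_seqP[B BE] sgG.
have /choice[n nP] : forall C, exists n, (0 < n)%N /\ (C \in B ->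
  forall y, C y -> G (y ^+ n)).
  move=> C; case: (boolP (C \in B)) => [CB|]; last by exists 1%N.
  have : [set` B] C by [].
  rewrite -BE => -[x [Hx [k k0 xk]] <-]; exists k; split=> // _ _ [z [Gz _] <-].
  by rewrite exprMn xk mul1r; exact: mul_subgroupX.
exists (\prod_(C <- B) n C)%N; first by rewrite prodn_gt0 // => C; case: (nP C).
move=> y Hy; have : cosets (mu_infty H) (mu_infty G) [set y * z | z in mu_infty
  G] by exists y.
rewrite BE => /= yB; have [_ /(_ yB y) h] := nP [set y * z | z in mu_infty G].
have [|k ->] := @dvdnP (n [set y * z | z in mu_infty G]) (\prod_(C <- B) n C)%N _.
  by rewrite (big_rem _ yB) /= dvdn_mulr.
rewrite mulnC exprM; apply: mul_subgroupX => //; apply: h; exists 1;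
  rewrite ?mulr1 //.
by split; [exact: mul_subgroup1 | exists 1%N; rewrite ?expr1].
Qed.

Lemma unity_roots_seq (L : closedFieldType) k : (0 < k)%N ->
  exists rs : seq L, forall y, y ^+ k = 1 -> y \in rs.
Proof.
move=> k0; have [rs rsE] := closed_field_poly_normal ('X^k - 1 : {poly L}).
exists rs => y yk.
have : root ('X^k - 1) y by rewrite rootE !hornerE yk subrr.
rewrite rsE rootZ ?root_prod_XsubC //.
by rewrite lead_coef_eq0 monic_neq0 // monicXnsubC.
Qed.

Section Main.
Variables (K : fieldType) (L : closedFieldType) (iota : {rmorphism K -> L}).
Hypothesis L_algebraic : integralRange iota.
Variable R : nat -> set L.
Hypothesis R_subgroup : forall N : nat, (0 < N)%N -> mul_subgroup (R N).
Hypothesis R_one : R 1%N `<=` base_units iota.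
Hypothesis R_power : forall N M : nat, (0 < N)%N -> (M %| N)%N ->
  power_set (R N) M = R (N %/ M)%N.
Let G := radical_group iota R.

(** Elements of any groups [G N] lying in [E] differ by a factor in [K^*] once the finite invariant
    [g] agrees on them. For each attained value [t], a level [f t] where it is attained is chosen,
    and [N0] is the product of these levels. *)
Lemma torsion_bounded (n : nat) (zeta : L) :
  n.-primitive_root zeta ->
  finite_set (cosets (mu_infty (nonzero (simple_ext iota zeta))) (mu_infty
    (base_units iota))) ->
  exists2 N0, (0 < N0)%N &
    forall N x, (0 < N)%N -> G N x -> simple_ext iota zeta x -> G N0 x.
Proof.
move=> zetaP fin; have [w w0 hw] :=
  torsion_index_exponent fin (base_units_subgroup iota).
have [p p0 pz] := integral_annihilator L_algebraic zeta.
have [m m_irr mz] := irreducible_annihilator p0 pz.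
have n0 := prim_order_gt0 zetaP.
have k0 : (0 < w * totient n)%N by rewrite muln_gt0 w0 totient_gt0.
have [rs rsP] := unity_roots_seq L k0.
have [T [g gP]] := torsion_finite_invariant zetaP m_irr mz rsP.
have GK N x : (0 < N)%N -> G N x -> simple_ext iota zeta x ->
    x != 0 /\ range iota (x ^+ (w * totient n)).
  move=> N0 Gx Ex.
  have x0 := mul_subgroup_neq0 (radical_group_subgroup iota R_subgroup N0) Gx.
  split=> //; apply: (torsion_exponent zetaP m_irr mz N0) => //.
    move=> y k Ey k_gt0 yk; have /hw[] // : mu_infty (nonzero (simple_ext iota
      zeta)) y.
    split; last by exists k.
    by split=> //; apply/eqP; exact: unity_root_neq0 k_gt0 yk.
  exact: radical_group_expn Gx.
have /choice[f fP] : forall t : T, exists N, (0 < N)%N /\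
    forall N' x', (0 < N')%N -> G N' x' -> simple_ext iota zeta x' -> g x' = t ->
    exists x, [/\ G N x, simple_ext iota zeta x & g x = t].
  move=> t; case: (pselect (exists N x, [/\ (0 < N)%N, G N x, simple_ext iota
    zeta x & g x = t])).
    by move=> [N [x [N0 Gx Ex gx]]]; exists N; split=> // _ _ _ _ _ _; exists x.
  (* A value that is never attained gets the harmless level [1]. *)
  move=> no; exists 1%N; split=> // N' x' N'0 Gx' Ex' gx'; exfalso; apply: no.
  by exists N', x'.
exists (\prod_(t : T) f t)%N; first by rewrite prodn_gt0 // => t; case: (fP t).
have P0 : (0 < \prod_(t : T) f t)%N by rewrite prodn_gt0 // => t; case: (fP t).
move=> N x N0 Gx Ex; have [ft0 /(_ N x N0 Gx Ex erefl)[y [Gy Ey gy]]] := fP (g x).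
have [x0 Fx] := GK N x N0 Gx Ex; have [y0 Fy] := GK _ y ft0 Gy Ey.
have Fxy := gP x y Ex Ey x0 y0 Fx Fy (esym gy).
rewrite -(mulfVK y0 x); apply: mul_subgroupM; first exact: radical_group_subgroup.
  apply: base_units_sub_radical_group => //; apply/nonzero_rangeP; split=> //.
  by rewrite mulf_neq0 ?invr_eq0.
apply: radical_group_sub Gy => //.
by rewrite (bigD1 (g x)) //= dvdn_mulr.
Qed.

(** Let [y] be [x] raised to the part of [N] prime to the characteristic, and [q] the remaining
    part. A separable irreducible annihilator of [y] divides [(X - y)^q], so it is linear and [y]
    lies in [K]. *)
Lemma separable_radical_torsion N x : (0 < N)%N ->
  separable_ext iota (adjoin iota (R N)) ->
  G N x -> exists m, [/\ (0 < m)%N, m%:R != 0 :> L & range iota (x ^+ m)].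
Proof.
move=> N0 sep Gx; exists (N`_[pchar K]^')%N.
have m0 : (0 < N`_[pchar K]^')%N by exact: part_gt0.
have mu : (N`_[pchar K]^')%:R != 0 :> L.
  by rewrite -(rmorph_nat iota) fmorph_eq0 natf_neq0_pchar part_pnat.
split=> //; set y := x ^+ _; set q := (N`_[pchar K])%N.
have q0 : (0 < q)%N by exact: part_gt0.
have sgG := radical_group_subgroup iota R_subgroup N0.
have yq : range iota (y ^+ q).
  by rewrite -exprM mulnC partnC //; apply: radical_group_expn Gx.
have : adjoin iota (R N) y.
  rewrite adjoin_sum_set //; last exact: R_subgroup.
  by apply: sum_set_mem; exact: mul_subgroupX.
case/sep => f [f_irr f_sep fy].
case: yq => k _ ky.
have fq : map_poly iota f %| ('X - y%:P) ^+ q.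
  have -> : ('X - y%:P) ^+ q = map_poly iota ('X^q - k%:P).
    rewrite rmorphB /= map_polyXn map_polyC /= ky.
    have qP : [pchar {poly L}].-nat q.
      apply: sub_in_pnat (part_pnat [pchar K] N) => p _.
      by rewrite pchar_poly (fmorph_pchar iota).
    by rewrite exprDn_pchar // exprNn_pchar // !polyC_exp.
  rewrite dvdp_map; apply: (irreducible_dvd_root f_irr fy).
  by rewrite rmorphB /= map_polyXn map_polyC /= ky rootE !hornerE subrr.
have [i _ fi] := dvdp_exp_XsubCP fq.
have i1 : (i <= 1)%N.
  rewrite leqNgt; apply/negP => i1.
  have sep' : separable_poly (map_poly iota f) by rewrite separable_map.
  have := separable_nosquare (u := 'X - y%:P) sep' i1.
  by rewrite size_XsubC (eqp_dvdr _ fi) dvdpp => /(_ isT).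
have sf : size f = 2.
  have := eqp_size fi; rewrite size_map_poly size_exp_XsubC => sf.
  by apply/eqP; rewrite eqn_leq {1}sf ltnS i1; case: f_irr.
have f1 : f`_1 != 0.
  have -> : f`_1 = lead_coef f by rewrite lead_coefE sf.
  by rewrite lead_coef_eq0 irredp_neq0.
move: fy; rewrite rootE horner_coef size_map_poly sf !big_ord_recl big_ord0 /=
  !coef_map.
rewrite expr0 mulr1 addr0 expr1 => /eqP e.
exists (- (f`_0 / f`_1)) => //.
rewrite rmorphN fmorph_div /=; apply/eqP; rewrite eq_sym -addr_eq0; apply/eqP.
have i1' : iota f`_1 != 0 by rewrite fmorph_eq0.
by apply: (mulfI i1'); rewrite mulr0 mulrDr mulrCA mulfV // mulr1 addrC.
Qed.

Variables (zeta : nat -> L).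
Hypothesis zetaP : coherent_roots K zeta.

(* If q does not divide n, write x = r e with r in R_N, e in K(zeta_n) and r of
   q-power order modulo K; then r = x / e lies in the abelian extension
   K(zeta_(nq)), and radical_root_unity takes q-th powers off down to r in K. *)
Lemma roots_of_unity_in_group (n N q : nat) (x : L) :
  [pchar K]^'.-nat n -> (0 < N)%N -> prime q ->
  (~~ (q %| n)%N -> q \notin [pchar K] ->
    base_units iota (zeta q) \/ forall M, (0 < M)%N -> ~ G M (zeta q)) ->
  mul_set (R N) (nonzero (simple_ext iota (zeta n))) x -> x ^+ q = 1 ->
  simple_ext iota (zeta n) x.
Proof.
move=> pn N0 qp hq; set E := simple_ext iota (zeta n).
have [prim coh] := zetaP; have zn := prim n pn.
have [p p0 pz] := integral_annihilator L_algebraic (zeta n).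
have [m m_irr mz] := irreducible_annihilator p0 pz.
have ER : E = range (subfx_inj : subFExtend iota (zeta n) p -> L).
  by rewrite range_subfx_inj.
have FE : range iota `<=` E by exact: simple_ext_range.
have zE : E (zeta n) by exact: simple_ext_gen.
have EX y i : E y -> E (y ^+ i) by exact: simple_extX.
move=> xH xq.
have [x1 | x1] := eqVneq x 1.
  by rewrite x1; apply: FE; exact: range1.
have qK : q \notin [pchar K].
  apply: contraNN x1 => qK; have qL : q \in [pchar L] by rewrite (fmorph_pchar
    iota).
  have qn : [pchar L].-nat q by rewrite pnatE.
  have : (x - 1) ^+ q == 0 by rewrite exprDn_pchar // xq exprNn_pchar // expr1n
    subrr.
  by rewrite expf_eq0 prime_gt0 // subr_eq0.
have nat_q : [pchar K]^'.-nat q by rewrite pnatE.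
have zq := prim q nat_q.
have [i xi] : exists i, x = zeta q ^+ i.
  by have /(prim_rootP zq)[i ->] := xq; exists i.
have [qn|qn] := boolP (q %| n)%N.
  have zqE : zeta q = zeta n ^+ (n %/ q) by rewrite coh.
  by rewrite xi zqE; apply/EX/EX.
have [[Fz _]|nz] := hq qn qK; first by rewrite xi; apply/FE/rangeX.
case: xH => r Rr [e [Ee /eqP e0] re].
have sgE : mul_subgroup (nonzero E) by rewrite ER; exact: nonzero_range_subgroup.
have r0 : r != 0 by apply: mul_subgroup_neq0 Rr; exact: R_subgroup.
(* By the Chinese remainder theorem [t] is [1] modulo [q] and divisible by the part of [N] prime to
   [q]. So [x ^+ t = x], while [r ^+ t] has [q]-power order modulo [K^*]. *)
have [t [tq tN]] : exists t, (t = 1 %[mod q] /\ (N %| t * N`_q))%N.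
  have cop : coprime q N`_q^' by apply: (@pnat_coprime q);
    rewrite ?pnat_id ?part_pnat.
  exists (chinese q N`_q^' 1 0); split; first by rewrite chinese_modl.
  rewrite -{1}(partnC q N0) mulnC dvdn_pmul2r ?part_gt0 //.
  by apply/eqP; rewrite chinese_modr // mod0n.
have xt : x ^+ t = x by rewrite xi -exprM -(prim_expr_mod zq) -modnMmr tq modnMmr
  muln1 (prim_expr_mod zq).
have Rrt : R N (r ^+ t) by apply: mul_subgroupX => //; exact: R_subgroup.
have Frt : range iota ((r ^+ t) ^+ N`_q).
  rewrite -exprM; have [k ->] := dvdnP tN; rewrite mulnC exprM.
  by apply: rangeX; exact: radical_expn Rr.
have nat_nq : [pchar K]^'.-nat (n * q)%N by rewrite pnatM pn.
have znq := prim _ nat_nq.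
have [p' p'0 p'z] := integral_annihilator L_algebraic (zeta (n * q)%N).
have [m' m'_irr m'z] := irreducible_annihilator p'0 p'z.
set E' := simple_ext iota (zeta (n * q)%N).
have q0 := prime_gt0 qp; have n0 := prim_order_gt0 zn.
have E'z : E' (zeta (n * q)%N) by exact: simple_ext_gen.
have E'X y j : E' y -> E' (y ^+ j) by exact: simple_extX.
have E'q : E' (zeta q).
  by rewrite -(coh q (n * q)%N) ?dvdn_mull //; exact: E'X.
have EE' : E `<=` E'.
  move=> _ [P _ <-]; rewrite -(coh n (n * q)%N) ?dvdn_mulr //.
  exists (P \Po 'X^(n * q %/ n)) => //.
  by rewrite map_comp_poly horner_comp map_polyXn hornerXn.
have E'r : E' (r ^+ t).
  have -> : r ^+ t = x / e ^+ t by rewrite -[in RHS]xt -re exprMn mulfK //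
    expf_neq0.
  apply: simple_extM => //; first by rewrite xi; apply: E'X.
  by apply: (simple_extV m'_irr m'z); apply/EE'/EX.
(* [radical_root_unity] writes [y] as an element of [K] times a [q]-th root of unity [w], which
   therefore lies in [G N]. If [w] were not [1], [zeta q] would be one of its powers, contradicting
   [nz]. *)
have key y : R N y -> E' y -> range iota (y ^+ q) -> range iota y.
  move=> Ry E'y Fy.
  have Gy : G N y by apply: mul_set_subl Ry; exact: base_units_subgroup.
  have y0 : y != 0 by apply: mul_subgroup_neq0 Ry; exact: R_subgroup.
  have sgG := radical_group_subgroup iota R_subgroup N0.
  have Fzq : ~ range iota (zeta q).
    move=> Fz; apply: (nz N N0); apply: base_units_sub_radical_group => //.
    apply/nonzero_rangeP; split=> //; apply: unity_root_neq0 q0 _.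
    exact: prim_expr_order.
  have [w wq Fyw] := radical_root_unity znq m'_irr m'z qp (dvdn_mull n (dvdnn q))
    (prim_expr_order zq) Fzq E'y y0 Fy.
  have w0 := unity_root_neq0 q0 wq.
  have [w1|w1] := eqVneq w 1; first by move: Fyw; rewrite w1 divr1.
  exfalso; apply: (nz N N0).
  have Gw : G N w.
    rewrite -(mulfVK y0 w); apply: mul_subgroupM => //.
    apply: base_units_sub_radical_group => //; apply/nonzero_rangeP; split.
      exact: range_divC.
    by rewrite mulf_neq0 ?invr_eq0.
  have [j ->] := unity_root_pow qp wq w1 (prim_expr_order zq).
  exact: mul_subgroupX.
have Fr : range iota (r ^+ t).
  move: Frt; rewrite p_part; elim: (logn q N) => [|l IHl];
    first by rewrite expn0 expr1.
  rewrite expnS mulnC exprM => h; apply: IHl; apply: key h; last exact: E'X.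
  by apply: mul_subgroupX => //; exact: R_subgroup.
rewrite -xt -re exprMn; apply: simple_extM => //; first exact: FE.
exact: EX.
Qed.

End Main.

Lemma sqrtN1_unity_root (K : fieldType) (n : nat) (z : K) :
  n.-primitive_root z -> (4 %| n)%N -> (z ^+ (n %/ 4)) ^+ 2 = -1.
Proof.
move=> zn n4; have n0 := prim_order_gt0 zn.
have : ((z ^+ (n %/ 4)) ^+ 2) ^+ 2 == 1.
  by rewrite -!exprM divnK // (prim_expr_order zn).
rewrite sqrf_eq1 => /orP[|/eqP//]; rewrite -exprM -(prim_order_dvd zn).
move=> /dvdn_leq; move/dvdnP: n4 n0 => [k ->]; rewrite mulnK // => k0.
by move=> h; exfalso; move: (h ltac:(lia)); lia.
Qed.

Theorem theorem5p4 (K : fieldType) (L : closedFieldType)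
  (iota : {rmorphism K -> L}) (L_algebraic : integralRange iota)
  (zeta : nat -> L) (zetaP : coherent_roots K zeta)
  (R : nat -> set L)
  (R_subgroup : forall N : nat, (0 < N)%N -> mul_subgroup (R N))
  (R_index : exists c : nat, forall N : nat, (0 < N)%N ->
     (group_index (mul_set (R N) (base_units iota)) (base_units iota) %| N ^ c)%N)
  (R_one : R 1%N `<=` base_units iota)
  (R_power : forall N M : nat, (0 < N)%N -> (M %| N)%N ->
     power_set (R N) M = R (N %/ M)%N)
  (primes_finite : finite_set (new_root_primes iota zeta R))
  (z : nat)
  (z_def : z = (\prod_(p <- fset_set (new_root_primes iota zeta R)) p)%N)
  (mu_finite : finite_set
     (cosets (mu_infty (nonzero (cyclotomic_ext iota zeta (4 * z))))
             (mu_infty (base_units iota)))) :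
  exists2 N0 : nat, (0 < N0)%N &
    forall N : nat, (0 < N)%N -> separable_ext iota (adjoin iota (R N)) ->
      kummer_ratio iota (R N) = kummer_ratio iota (R (gcdn N N0)).
Proof.
have z_gt0 : (0 < z)%N.
  rewrite z_def big_seq; apply: prodn_cond_gt0 => p.
  by rewrite in_fset_set // inE => -[/prime_gt0].
set n := ((4 * z)`_([pchar K]^'))%N.
have nat_n : [pchar K]^'.-nat n by exact: part_pnat.
have zn := zetaP.1 n nat_n.
have dvd_n p : [pchar K]^'.-nat p -> (p %| 4 * z -> p %| n)%N.
  move=> pp pz; rewrite -(part_pnat_id pp); apply: partn_dvd => //.
  by rewrite muln_gt0 z_gt0.
rewrite /cyclotomic_ext -/n (adjoin_simple L_algebraic) in mu_finite.
have [N0 N0_gt0 bounded] :=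
  torsion_bounded L_algebraic R_subgroup R_one R_power zn mu_finite.
exists N0 => // N N_gt0 sep; set N' := gcdn N N0.
have N'_gt0 : (0 < N')%N by rewrite gcdn_gt0 N_gt0.
have N'N : (N' %| N)%N := dvdn_gcdl N N0.
have [p p0 pz] := integral_annihilator L_algebraic (zeta n).
pose iota2 : {rmorphism subFExtend iota (zeta n) p -> L} := subfx_inj.
have EE : range iota2 = simple_ext iota (zeta n) by apply: range_subfx_inj.
have FE : range iota `<=` range iota2 by rewrite EE; exact: simple_ext_range.
have KE : base_units iota `<=` nonzero (range iota2).
  by move=> x [/FE Fx x0]; split.
have sgK := base_units_subgroup iota.
have sgE := nonzero_range_subgroup iota2.
have sgG M (M0 : (0 < M)%N) := radical_group_subgroup iota R_subgroup M0.
have KG M : (0 < M)%N -> base_units iota `<=` radical_group iota R M.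
  exact: base_units_sub_radical_group.
have index_gt0 M : (0 < M)%N ->
  (0 < group_index (radical_group iota R M) (base_units iota))%N.
  move=> M0; have [c /(_ M M0)] := R_index; apply: dvdn_gt0.
  by rewrite expn_gt0 M0.
have [u [uG ucov]] := cover_of_group_index (sgG N N_gt0) sgK (index_gt0 N N_gt0).
have [u' [u'G u'cov]] :=
  cover_of_group_index (sgG N' N'_gt0) sgK (index_gt0 N' N'_gt0).
have [t tr_t] := transversal_of_cover (sgG N' N'_gt0) sgK u'G u'cov.
have [|s tr_s] := transversal_of_cover (sgG N N_gt0) (sgG N' N'_gt0) uG.
  by move=> x /ucov[y yu Kxy]; exists y => //; exact: KG.
have R'R := radical_sub R_subgroup R_power N_gt0 N'N.
apply: (kummer_ratio_eq L_algebraic FE (R_subgroup _ N_gt0) (R_subgroup _ N'_gt0)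
  R'R _ _ tr_s tr_t).
  move=> x GNx Ex; apply: (radical_group_gcd R_subgroup R_power) => //.
  by apply: (bounded N) => //; rewrite -EE.
have HE := mul_set_subgroup (R_subgroup N N_gt0) sgE.
(* The representatives [u] of [G_N] modulo [K^*] also cover [R_N E^*] modulo [E^*], which provides
   the finite cover. *)
apply: (kneser (n := size u) (t := u)) => //.
- exact: mul_set_subr (R_subgroup _ N_gt0).
- move=> _ [r Rr [e [Ee _] <-]].
  have [|m [m0 mu Fr]] := separable_radical_torsion L_algebraic R_subgroup R_one
    R_power N_gt0 sep (x := r).
    exact: mul_set_subl sgK _ Rr.
  by exists m; split=> //; rewrite exprMn; apply: rangeM;
    [exact: FE | exact: rangeX].
- move=> q x qp; rewrite EE => xH xq.
  apply: (roots_of_unity_in_group L_algebraic R_subgroup R_one R_power zetaP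
    nat_n N_gt0 qp _ xH xq).
  move=> qn qK; have nat_q : [pchar K]^'.-nat q by rewrite pnatE.
  (* A prime in [new_root_primes] divides [z], hence also [n]. So [q] is not one of them: either
     [zeta q] lies in [K], or it lies in no [G_M]. *)
  have qz : q \notin fset_set (new_root_primes iota zeta R).
    apply: contra qn => qs; apply: dvd_n => //; apply: dvdn_mull.
    by rewrite z_def (big_rem _ qs) /= dvdn_mulr.
  case: (pselect (base_units iota (zeta q))) => [|Kzq]; [by left | right=> M M0 GM].
  move/negP: qz; apply; rewrite in_fset_set // inE; split=> //.
  by exists M.
(* A square root of [-1] in [E]: in characteristic 2 the number [n] is odd, but [-1 = 1]; otherwise
   [4] divides [n] and [zeta n ^+ (n %/ 4)] serves. *)
- have [K2 | K2] := boolP (2 \in [pchar K]).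
    exists 1; rewrite expr1n; apply/eqP; rewrite -addr_eq0.
    have : 2 \in [pchar subFExtend iota (zeta n) p].
      by rewrite -(fmorph_pchar iota2) (fmorph_pchar iota).
    by rewrite inE.
  have n4 : (4 %| n)%N.
    apply: dvd_n; last exact: dvdn_mulr.
    by rewrite (pnatX _ 2 2) pnatE // orbC.
  have : range iota2 (zeta n ^+ (n %/ 4)).
    by rewrite EE; apply/simple_extX/simple_ext_gen.
  case=> i _ iE; exists i; apply: (fmorph_inj iota2).
  by rewrite rmorphXn /= rmorphN1 -(sqrtN1_unity_root zn n4) -iE.
- by move=> y /uG [r Rr [k Kk <-]]; exists r => //; exists k => //; exact: KE.
- move=> _ [r Rr [e [Ee e0] <-]].
  have [|y yu [Fry _]] := ucov r; first exact: mul_set_subl sgK _ Rr.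
  by exists y => //; rewrite mulrAC; apply: rangeM => //; exact: FE.
Qed.
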